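(* Let $(E,E')$ and $(F,F')$ be complete dual pairs, let $U\subseteq E$ be $c^\infty$-open, and let $f:U\to F$ be a mapping. Then $f$ is real analytic if and only if $f$ is smooth and for all $\lambda\in F'$ the function $\lambda\circ f$ is real analytic along each affine line in $E$ (i.e. for all $x\in U$ and $v\in E$ the function $t\mapsto \lambda(f(x+tv))$ is real analytic on $\{t\in\mathbb R: x+tv\in U\}$).
   Context: A dual pair $(E,E')$ is a real vector space $E$ together with a linear subspace $E'$ of its algebraic dual which separates points of $E$. A set $B\subseteq E$ is bounded if $\lambda(B)$ is bounded in $\mathbb R$ for all $\lambda\in E'$. For a bounded absolutely convex set $A$ let $E_A$ be the linear span of $A$ normed by the Minkowski functional of $A$. The dual pair $(E,E')$ is complete if every bounded set is contained in a bounded absolutely convex set $A$ such that $E_A$ is a Banach space. A curve $c:\mathbb R\to E$ is called smooth (resp. real analytic) if $\lambda\circ c:\mathbb R\to\mathbb R$ is smooth (resp. real analytic) for all $\lambda\in E'$. A subset $U\subseteq E$ is $c^\infty$-open if $c^{-1}(U)$ is open in $\mathbb R$ for every smooth curve $c:\mathbb R\to E$. A mapping $f:U\to F$ is smooth if $f\circ c$ is a smooth curve in $F$ for every smooth curve $c:\mathbb R\to E$ with $c(\mathbb R)\subseteq U$; it is real analytic if it is smooth and moreover $f\circ c$ is a real analytic curve in $F$ for every real analytic curve $c:\mathbb R\to E$ with $c(\mathbb R)\subseteq U$. *)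

(* Defs.v *)
From HB Require Import structures.
From mathcomp Require Import all_boot all_order all_algebra.
From mathcomp Require Import all_classical all_reals all_analysis.

Set Implicit Arguments.
Unset Strict Implicit.
Unset Printing Implicit Defensive.

Import Order.TTheory GRing.Theory Num.Theory.
Import numFieldNormedType.Exports.

Local Open Scope classical_set_scope.
Local Open Scope ring_scope.

Section RealFunctions.
Context {R : realType}.
Implicit Types (g : R -> R) (t : R).

Definition smooth_fun g : Prop := forall n t, derivable (derive1n n g) t 1.

Definition analytic_at g t : Prop :=
  exists a : R^nat, \forall s \near t, pseries a (s - t) @ \oo --> g s.

Definition analytic_fun g : Prop := forall t, analytic_at g t.

End RealFunctions.

Section DualPairs.
Context {R : realType} {E : lmodType R}.
Implicit Types (A B U : set E) (c : R -> E).

Record dual_pair (E' : set (E -> R)) : Prop := DualPair {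
  dual_pair_scalar : forall l, E' l -> scalar l ;
  dual_pair0 : E' (fun=> 0) ;
  dual_pairD : forall l m, E' l -> E' m -> E' (fun x => l x + m x) ;
  dual_pairZ : forall (a : R) l, E' l -> E' (fun x => a * l x) ;
  dual_pair_separates : forall x y, x != y -> exists2 l, E' l & l x != l y
}.

Definition dp_bounded (E' : set (E -> R)) B : Prop := forall l, E' l -> bounded_set (l @` B).

(* Nonemptiness excludes the empty set, which has no Minkowski functional. *)
Definition absolutely_convex A : Prop :=
  [/\ A !=set0, convex_set A &
      forall (a : R) x, `|a| <= 1 -> A x -> A (a *: x)].

Definition linear_span A : set E :=
  [set x | exists n (a : 'I_n -> R) (v : 'I_n -> E),
     (forall i, A (v i)) /\ x = \sum_(i < n) a i *: v i].

Definition minkowski_functional A (x : E) : R :=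
  inf [set r | 0 < r /\ exists2 y, A y & x = r *: y].

(* [linear_span A] carries no canonical norm (the Minkowski functional is a
   norm on it only for suitable [A]), so that E_A is a Banach space is expressed
   by a linear isometric bijection from a library Banach space onto it. *)
Definition banach_span A : Prop :=
  exists (X : completeNormedModType R) (i : {linear X -> E}),
    set_bij [set: X] (linear_span A) i /\
    forall x : X, `|x| = minkowski_functional A (i x).

Definition dp_complete (E' : set (E -> R)) : Prop :=
  forall B, dp_bounded E' B ->
    exists A, [/\ B `<=` A, dp_bounded E' A, absolutely_convex A &
                  banach_span A].

Definition smooth_curve (E' : set (E -> R)) c : Prop :=
  forall l, E' l -> smooth_fun (l \o c).

Definition analytic_curve (E' : set (E -> R)) c : Prop :=
  forall l, E' l -> analytic_fun (l \o c).

Definition cinfty_open (E' : set (E -> R)) U : Prop :=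
  forall c, smooth_curve E' c -> open (c @^-1` U).

End DualPairs.

(* Maps U -> F are represented by functions on all of E; only their values on U
   are used. *)
Section Maps.
Context {R : realType} {E F : lmodType R}.
Variables (E' : set (E -> R)) (F' : set (F -> R)) (U : set E).
Implicit Types f : E -> F.

Definition smooth_map f : Prop :=
  forall c : R -> E, smooth_curve E' c -> range c `<=` U ->
    smooth_curve F' (f \o c).

Definition analytic_map f : Prop :=
  smooth_map f /\
  forall c : R -> E, analytic_curve E' c -> range c `<=` U ->
    analytic_curve F' (f \o c).

(* If U is c^oo-open, the set of t such that x + t v lies in U is open in R, so
   analyticity at its points does not depend on the values of f outside U. *)
Definition analytic_along_lines f : Prop :=
  forall l, F' l -> forall x v, U x ->
    forall t : R, U (x + t *: v) ->
      analytic_at (fun s : R => l (f (x + s *: v))) t.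

End Maps.

(* Main.v *)
(* The proof of the nontrivial implication reduces to F = R by composing f with
   a functional; let c be a real analytic curve and suppose that f o c is not
   analytic at t0. Then there are points a_n -> t0, orders k_n and arbitrarily
   small steps tau_n at which the k_n-th difference of f o c exceeds
   tau_n^(k_n) n^(2 k_n + 1) k_n!. The vectors (c(s) - c(t0)) / (s - t0) at the
   nodes s = a_n + i tau_n and the Newton coefficients
   Delta^j c(a_n) / (tau_n^j j! n^j), 0 < j <= k_n, form a bounded set,
   although the power series of c may have radius of convergence zero in every
   E_A; so they lie in the unit ball of a Banach space X = E_A.
     On X the function y |-> f(c(t0) + y) is the sum of homogeneous polynomials
   p_m with |p_m(y)| <= K^(m+1) |y|^m. Here smooth curves through fast
   converging sequences give continuity and show that the p_m, which are
   defined along lines, are polynomials; the bound follows from Baire's theorem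
   and polarization, and the sum is f by the identity theorem on segments.
     Since Newton's formula reproduces c exactly at the nodes, expanding the
   p_m along it bounds the k_n-th difference by
   tau_n^(k_n) k_n! K (C n)^(k_n), a contradiction for large n.
     Conversely, analyticity along the bounded curve x + (t + e (L(s) - 1/2)) v
   with L the logistic function is carried back to the line by the same
   estimate, L having the explicit analytic inverse logit. *)
Require Import Defs.
From HB Require Import structures.
From mathcomp Require Import all_boot all_order all_algebra.
From mathcomp Require Import all_classical all_reals all_analysis.
From mathcomp Require Import ring lra zify.

Set Implicit Arguments.
Unset Strict Implicit.
Unset Printing Implicit Defensive.

Import Order.TTheory GRing.Theory Num.Theory.
Import numFieldNormedType.Exports.

Local Open Scope classical_set_scope.
Local Open Scope ring_scope.

(** * Finite differences *)

Section FiniteDifferences.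
Context {V W : zmodType}.
Implicit Types (s : seq V) (g h : V -> W) (x w : V).

(** Differences replace derivatives because the analyticity of [c] is only tested by functionals,
    each with a radius of its own, so that [c] cannot be differentiated inside a Banach space E_A.
    Differences commute with functionals, and Newton's formula is an identity between finitely many
    vectors, so both can be lifted to E_A. The obstacle is that a bounded set must be fixed before
    E_A exists; the assumed failure of analyticity supplies a countable one. Its Newton coefficients
    are divided by n^j since no single Cauchy constant serves all functionals, while for each
    functional n exceeds the constant from some index on; the remaining indices contribute finitely
    many vectors. *)

Fixpoint fdiff s g x : W :=
  if s is w :: s' then fdiff s' g (x + w) - fdiff s' g x else g x.

Lemma fdiff_cat s1 s2 g : fdiff (s1 ++ s2) g = fdiff s1 (fdiff s2 g).
Proof. by apply/funext; elim: s1 => //= w s1 IH x; rewrite !IH. Qed.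

Lemma fdiff_eq0 s x : fdiff s (fun=> 0) x = 0.
Proof. by elim: s x => //= w s IH x; rewrite !IH subrr. Qed.

Lemma fdiffD s g h x : fdiff s (fun y => g y + h y) x = fdiff s g x + fdiff s h x.
Proof. by elim: s x => //= w s IH x; rewrite !IH opprD addrACA. Qed.

Lemma fdiffN s g x : fdiff s (fun y => - g y) x = - fdiff s g x.
Proof. by elim: s x => //= w s IH x; rewrite !IH opprD. Qed.

Lemma fdiff_sum (I : Type) (r : seq I) (G : I -> V -> W) s x :
  fdiff s (fun y => \sum_(i <- r) G i y) x = \sum_(i <- r) fdiff s (G i) x.
Proof.
elim: r => [|i r IH].
  by rewrite big_nil -[RHS](fdiff_eq0 s x); congr (fdiff _ _ _);
    apply/funext => y; rewrite big_nil.
rewrite big_cons -IH -fdiffD; congr (fdiff _ _ _).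
by apply/funext => y; rewrite big_cons.
Qed.

Lemma fdiff_has0 s g x : 0 \in s -> fdiff s g x = 0.
Proof.
elim: s x => //= w s IH x; rewrite inE => /orP[/eqP<-|s0].
  by rewrite addr0 subrr.
by rewrite !IH// subrr.
Qed.

Lemma fdiff_nseqE n w g x :
  fdiff (nseq n w) g x =
  \sum_(i < n.+1) g (x + w *+ i) *+ 'C(n, i) *~ (-1) ^+ (n - i).
Proof.
elim: n x => [|n IH] x; first by rewrite big_ord1 /= mulr0n addr0 mulr1n.
rewrite /= !IH [X in _ - X]big_ord_recl [RHS]big_ord_recl /=.
rewrite [X in X - _](_ : _ = \sum_(i < n.+1)
   g (x + w *+ i.+1) *+ 'C(n, i) *~ (-1) ^+ (n - i)); last first.
  by apply: eq_bigr => i _; rewrite -addrA -mulrS.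
rewrite opprD addrCA; congr (_ + _).
  by rewrite !bin0 !subn0 exprS mulN1r mulrNz.
rewrite -sumrN.
rewrite [X in _ + X](_ : _ = \sum_(i < n.+1)
   - (g (x + w *+ i.+1) *+ 'C(n, i.+1) *~ (-1) ^+ (n - i.+1))); last first.
  by rewrite [RHS]big_ord_recr /= bin_small// mulr0n mul0rz oppr0 addr0.
rewrite -big_split /=; apply: eq_bigr => i _.
rewrite /bump /= add1n binS subSS mulrnDr mulrzDl addrC; congr (_ + _).
have [lt_in|le_ni] := ltnP i n; last by rewrite bin_small ?ltnS// !mulr0n !mul0rz oppr0.
by rewrite -[in RHS](subnSK lt_in) exprS mulN1r mulrNz.
Qed.

(** The range [k] is common to all [i <= k], surplus terms being killed by 'C(i, j) = 0. The points
    of a progression thus appear as values of one polynomial in [i]. *)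
Lemma fdiff_newton w g x k i : (i <= k)%N ->
  g (x + w *+ i) = \sum_(j < k.+1) fdiff (nseq j w) g x *+ 'C(i, j).
Proof.
elim: i x k => [|i IH] x k le_ik.
  rewrite big_ord_recl big1 /=; first by rewrite mulr0n !addr0 mulr1n.
  by move=> j _; rewrite mulr0n.
rewrite mulrS addrA (IH _ k (ltnW le_ik)).
rewrite [RHS]big_ord_recl /=.
transitivity (\sum_(j < k.+1) (fdiff (nseq j w) g x *+ 'C(i, j) +
   fdiff (nseq j.+1 w) g x *+ 'C(i, j))).
  by apply: eq_bigr => j _; rewrite -mulrnDl /= addrCA subrr addr0.
rewrite big_split /= big_ord_recl /= bin0 -addrA; congr (_ + _).
rewrite [X in _ + X]big_ord_recr /= (bin_small le_ik).
rewrite mulr0n addr0 -big_split /=; apply: eq_bigr => j _.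
by rewrite binS mulrnDr.
Qed.

End FiniteDifferences.

Lemma fdiff_shift (U V W : zmodType) (L : U -> V) (y : V) (s : seq U)
    (g : V -> W) (x : U) : {morph L : a b / a + b} ->
  fdiff s (fun z => g (y + L z)) x = fdiff (map L s) g (y + L x).
Proof. by move=> LD; elim: s x => //= w s IH x; rewrite !IH LD addrA. Qed.

Lemma fdiff_comp (V W Z : zmodType) (l : W -> Z) (s : seq V) (g : V -> W) (x : V) :
  {morph l : a b / a - b} -> l (fdiff s g x) = fdiff s (l \o g) x.
Proof. by move=> lB; elim: s x => //= w s IH x; rewrite lB !IH. Qed.

Section Polarization.
Context {V W : zmodType} (n : nat) (g : V -> W).
Hypothesis g0 : forall s x, size s = n.+1 -> fdiff s g x = 0.

Lemma fdiff_base s x : size s = n -> fdiff s g x = fdiff s g 0.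
Proof.
move=> sn; have /= := @g0 (x :: s) 0; rewrite sn add0r => /(_ erefl)/eqP.
by rewrite subr_eq0 => /eqP.
Qed.

(** The defect of additivity is itself a difference: the one along u + v minus those along u and v
    is the mixed one along u, v, which raises the order to [n.+1]. *)
Lemma fdiff_additive s1 s2 u v x : (size s1 + size s2).+1 = n ->
  fdiff (s1 ++ (u + v) :: s2) g x =
  fdiff (s1 ++ u :: s2) g x + fdiff (s1 ++ v :: s2) g x.
Proof.
move=> sn; apply/eqP; rewrite -subr_eq0; apply/eqP.
rewrite opprD addrA !fdiff_cat -fdiffN -fdiffD -fdiffN -fdiffD.
have := @g0 (s1 ++ u :: v :: s2) x.
rewrite size_cat /= !addnS sn fdiff_cat => /(_ erefl) <-.
congr (fdiff _ _ _); apply/funext => y /=.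
by rewrite addrA [in - (fdiff s2 g (y + u) - _)]opprB addrA subrK.
Qed.

End Polarization.

(* Djokovic's argument: apply the mixed difference in the directions
   [(s_j, - s_j / (j + 1))] to [(y, u) |-> fdiff (nseq n u) g y]. In Newton's
   expansion the term with shift [i * u] only sees the directions
   [(1 - i / (j + 1)) s_j], one of which vanishes unless [i = 0]. *)
Lemma fdiff_polarize (R : numFieldType) (V : lmodType R) (W : zmodType)
    (g : V -> W) (n : nat) :
  (forall u x, fdiff (nseq n u) g x = 0) ->
  forall s x, size s = n -> fdiff s g x = 0.
Proof.
move=> g0 s x sn.
pose H (p : V * V) := fdiff (nseq n p.2) g p.1.
pose dirs := [seq (s`_j, - (j.+1%:R^-1 *: s`_j)) | j <- iota 0 n].
pose L i (p : V * V) := p.1 + p.2 *+ i.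
have LD i : {morph L i : a b / a + b}.
  by move=> a b; rewrite /L /= mulrnDl addrACA.
have H0 : fdiff dirs H (x, 0) = 0.
  rewrite -[RHS](fdiff_eq0 dirs ((x, 0) : V * V)); congr (fdiff _ _ _).
  by apply/funext => p; exact: g0.
have HE : H = fun p => \sum_(i < n.+1) g (0 + L i p) *+ 'C(n, i) *~ (-1) ^+ (n - i).
  apply/funext => p; rewrite /H fdiff_nseqE; apply: eq_bigr => i _.
  by rewrite add0r.
have sE : [seq s`_j | j <- iota 0 n] = s by rewrite -sn; exact: mkseq_nth.
move: H0; rewrite HE fdiff_sum.
under eq_bigr => i _.
  rewrite -(@fdiff_comp _ _ _ (fun w => w *+ 'C(n, i) *~ (-1) ^+ (n - i)) _ (fun p => g (0 + L i p))); last first.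
    by move=> a b; rewrite mulrnBl mulrzBl.
  rewrite (@fdiff_shift _ _ _ (L i) 0)//.
  over.
rewrite big_ord_recl big1 ?addr0 => [|i _]; last first.
  rewrite fdiff_has0 ?mul0rn ?mul0rz//.
  rewrite -map_comp; apply/mapP; exists (nat_of_ord i); first by rewrite mem_iota/= add0n.
  by rewrite /L /= /bump /= add1n mulNrn scalerMnl -[_ *+ _]mulr_natr mulVf ?pnatr_eq0// scale1r subrr.
rewrite -map_comp (eq_map (_ : _ =1 (fun j => s`_j))); last first.
  by move=> j; rewrite /L /= mulr0n addr0.
rewrite sE bin0 mulr1n /L /= mulr0n !addr0 add0r subn0 => /eqP.
by rewrite -signr_odd; case: odd; rewrite ?mulrN1z ?oppr_eq0 ?mulr1z => /eqP.
Qed.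

Lemma fdiff_horner (R : realType) (q : {poly R}) (k : nat) (x : R) :
  (size q <= k.+1)%N -> fdiff (nseq k 1) (horner q) x = q`_k *+ k`!.
Proof.
elim: k q x => [|k IH] q x szq.
  by rewrite /= {1}(size1_polyC szq) hornerC mulr1n.
(* By Taylor's formula [r] is the first difference of [q]; its degree bound is one lower and its
   coefficient at [k] is k + 1 times that of [q] at [k.+1]. *)
pose r := \sum_(i < k.+1) q^`N(i.+1).
have rE : forall y, r.[y] = q.[y + 1] - q.[y].
  move=> y; rewrite (nderiv_taylor_wide _ szq); last exact: mulrC.
  rewrite big_ord_recl /= nderivn0 expr0 mulr1 addrAC subrr add0r.
  rewrite /r horner_sum; apply: eq_bigr => i _.
  by rewrite expr1n mulr1.
have szr : (size r <= k.+1)%N.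
  apply: (leq_trans (size_sum _ _ _)); apply/bigmax_leqP => i _.
  apply/leq_sizeP => j kj; rewrite coef_nderivn.
  by move/leq_sizeP: szq => ->; rewrite ?mul0rn// addSn ltnS (leq_trans kj) ?leq_addl.
have := IH r x szr.
have -> : horner r = fdiff [:: 1] (horner q) by apply/funext => y; rewrite rE.
rewrite -fdiff_cat -(nseqD k 1) addn1 => ->.
rewrite coef_sum big_ord_recl big1 ?addr0 => [|i _].
  by rewrite coef_nderivn add1n bin1 -mulrnA factS.
rewrite coef_nderivn; move/leq_sizeP: szq => ->; rewrite ?mul0rn//.
by rewrite lift0 !addSn !ltnS leq_addl.
Qed.

(** * Alternating binomial sums *)

Section AlternatingSum.
Context {R : realType}.
Implicit Types (u : nat -> R) (k : nat).

(** Stated for sequences because the points at which the forms are evaluated later need not be in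
    arithmetic progression. *)
Definition altsum k u : R := \sum_(i < k.+1) u i *+ 'C(k, i) *~ (-1) ^+ (k - i).

Lemma fdiff_altsum (V : zmodType) k w (g : V -> R) x :
  fdiff (nseq k w) g x = altsum k (fun i => g (x + w *+ i)).
Proof. exact: fdiff_nseqE. Qed.

Lemma eq_altsum k u v : (forall i, (i <= k)%N -> u i = v i) -> altsum k u = altsum k v.
Proof. by move=> uv; apply: eq_bigr => i _; rewrite uv// -ltnS. Qed.

Lemma altsum_sum (I : Type) (r : seq I) (U : I -> nat -> R) k :
  altsum k (fun i => \sum_(j <- r) U j i) = \sum_(j <- r) altsum k (U j).
Proof.
rewrite /altsum exchange_big /=; apply: eq_bigr => i _.
by rewrite -sumrMnl mulrz_suml.
Qed.

Lemma altsumZ k a u : altsum k (fun i => a * u i) = a * altsum k u.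
Proof.
by rewrite mulr_sumr; apply: eq_bigr => i _; rewrite mulrzAr -mulrnAr.
Qed.

Lemma altsum_bound k u (B : R) : (forall i, (i <= k)%N -> `|u i| <= B) ->
  `|altsum k u| <= 2 ^+ k * B.
Proof.
move=> uB; rewrite -[2]/(1 + 1) exprDn mulr_suml.
apply: le_trans (ler_norm_sum _ _ _) _; apply: ler_sum => i _.
have -> : `|u i *+ 'C(k, i) *~ (-1) ^+ (k - i)| = `|u i| *+ 'C(k, i).
  by rewrite -signr_odd; case: odd; rewrite ?mulrN1z ?mulr1z ?normrN normrMn.
by rewrite !expr1n mulr1 mulr_natl ler_wMn2r// uB// -ltnS.
Qed.

Lemma altsum_horner k (q : {poly R}) :
  (size q <= k.+1)%N -> altsum k (fun i => q.[i%:R]) = q`_k *+ k`!.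
Proof.
move=> szq; rewrite -(fdiff_horner 0 szq) fdiff_altsum.
by apply: eq_altsum => i _; rewrite add0r.
Qed.

Lemma altsum_horner0 k (q : {poly R}) :
  (size q <= k)%N -> altsum k (fun i => q.[i%:R]) = 0.
Proof.
by move=> szq; rewrite altsum_horner ?(leqW szq)// nth_default// mul0rn.
Qed.

Lemma cvg_altsum (T : Type) (F : set_system T) (FF : Filter F) k
    (U : T -> nat -> R) (l : nat -> R) :
  (forall i, (i <= k)%N -> U ^~ i @ F --> l i) ->
  altsum k (U x) @[x --> F] --> altsum k l.
Proof.
move=> Ul; apply: cvg_big => [|i _]; first exact: add_continuous.
rewrite -mulrzl -mulr_natl; under eq_fun do rewrite -mulrzl -mulr_natl.
by do 2 apply: cvgMl_tmp; apply: Ul; rewrite -ltnS.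
Qed.

(** Newton's weight 'C(i, j) as a polynomial in i of degree j. Products of such weights have
    additive degrees, and [altsum] annihilates them while the total stays below k. *)
Definition bin_poly j : {poly R} :=
  (j`!%:R)^-1 *: \prod_(q < j) ('X - (q%:R)%:P).

Lemma size_bin_poly j : (size (bin_poly j) <= j.+1)%N.
Proof.
by rewrite (leq_trans (size_scale_leq _ _))// size_prod_XsubC /index_enum -enumT size_enum_ord.
Qed.

Lemma horner_bin_poly j i : (bin_poly j).[i%:R] = 'C(i, j)%:R.
Proof.
rewrite hornerZ horner_prod.
apply: (mulfI (_ : j`!%:R != 0)); first by rewrite pnatr_eq0 -lt0n fact_gt0.
rewrite mulrA mulfV ?mul1r ?pnatr_eq0 -?lt0n ?fact_gt0// -natrM mulnC bin_ffact.
elim: j => [|j IH]; first by rewrite big_ord0 ffactn0.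
rewrite big_ord_recr /= IH ffactnSr natrM hornerXsubC.
have [ji|ij] := leqP j i; first by rewrite natrB.
by rewrite ffact_small// !mul0r.
Qed.

End AlternatingSum.

(* The Cauchy estimate replacing the Faa di Bruno formula: it bounds the [k]-th
   difference of [\sum_m A m (y, ..., y)] along the nodes [y = Y i]
   interpolated by Newton's formula with differences [W j]. *)
Section CauchyEstimate.
Context {R : realType} {X : normedModType R}.
Variables (A : nat -> seq X -> R) (K : R).
Hypothesis additiveA : forall m s1 s2 u v, (size s1 + size s2).+1 = m ->
  A m (s1 ++ (u + v) :: s2) = A m (s1 ++ u :: s2) + A m (s1 ++ v :: s2).
Hypothesis boundA : forall m s, size s = m -> all (fun w => `|w| <= 1) s ->
  `|A m s| <= K ^+ m.+1 * \prod_(w <- s) `|w|.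

Let A0 m s1 s2 : (size s1 + size s2).+1 = m -> A m (s1 ++ 0 :: s2) = 0.
Proof.
move=> sm; have := additiveA 0 0 sm; rewrite addr0 => /eqP.
by rewrite -subr_eq0 opprD addrA subrr sub0r oppr_eq0 => /eqP.
Qed.

(** Newton's weights are natural numbers, so additivity expands a form along them. *)
Let A_sum m s1 s2 n (c : nat -> nat) (W : nat -> X) :
  (size s1 + size s2).+1 = m ->
  A m (s1 ++ (\sum_(j < n) W j *+ c j) :: s2) =
  \sum_(j < n) (c j)%:R * A m (s1 ++ W j :: s2).
Proof.
move=> sm; elim: n => [|n IH]; first by rewrite !big_ord0 A0.
rewrite !big_ord_recr /= additiveA// IH; congr (_ + _).
elim: (c n) => [|p IHp]; first by rewrite mul0r mulr0n A0.
by rewrite mulrS additiveA// IHp -addn1 natrD mulrDl mul1r addrC.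
Qed.

Variables (W : nat -> X) (k : nat) (eta sigma rho : R).
Hypotheses (K0 : 0 <= K) (rho0 : 0 <= rho) (rho1 : rho <= 1)
  (sigma0 : 0 <= sigma) (sigma1 : sigma <= 1) (eta1 : eta <= 1).
Hypothesis W0 : `|W 0%N| <= eta.
(** The factor rho^j pays for the degree j of the weight attached to [W j]; sigma^j makes the sum
    over j small. *)
Hypothesis WS : forall j, (0 < j <= k)%N -> 'C(k, j)%:R * `|W j| <= (rho * sigma) ^+ j.

Let Y i := \sum_(j < k.+1) W j *+ 'C(i, j).
Let S := eta + \sum_(j < k) sigma ^+ j.+1.

Let W_le1 j : (j <= k)%N -> `|W j| <= 1.
Proof.
case: j => [_|j jk]; first exact: le_trans W0 eta1.
have := WS (_ : 0 < j.+1 <= k)%N => /(_ jk) Wj.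
apply: le_trans (_ : 'C(k, j.+1)%:R * `|W j.+1| <= _).
  by rewrite ler_peMl// ler1n bin_gt0.
apply: le_trans Wj _; rewrite exprn_ile1// ?mulr_ge0//.
by rewrite mulr_ile1.
Qed.

(** Arguments are expanded one at a time: [s] holds the coefficients already chosen, [h] the product
    of their weights, and [m] counts the arguments still to be expanded. Choosing [W j] brings a
    factor rho^j and raises [d] by j, so rho^(k - d) is what remains to be gained. *)
Let term_bound m s d (h : {poly R}) (H : R) : (size h <= d.+1)%N ->
    (forall i, (i <= k)%N -> `|h.[i%:R]| <= H) ->
    all (fun w => `|w| <= 1) s ->
  `|altsum k (fun i => h.[i%:R] * A (m + size s) (nseq m (Y i) ++ s))| <=
  2 ^+ k * H * rho ^+ (k - d) * (K ^+ (m + size s).+1 * S ^+ m * \prod_(w <- s) `|w|).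
Proof.
elim: m s d h H => [|m IH] s d h H szh hH s1.
  rewrite add0n /= expr0 mulr1.
  have H0 : 0 <= H by exact: le_trans (hH 0%N isT).
  have -> : altsum k (fun i => h.[i%:R] * A (size s) s) =
    A (size s) s * altsum k (fun i => h.[i%:R]).
    by rewrite -altsumZ; apply: eq_altsum => i _; rewrite mulrC.
  (* For d < k the alternating sum vanishes; otherwise the truncated k - d is 0 and the trivial
     bound suffices. *)
  have [kd|dk] := leqP k d; last first.
    rewrite altsum_horner0 ?mulr0 ?normr0; last exact: leq_trans szh dk.
    by rewrite !mulr_ge0 ?exprn_ge0 ?prodr_ge0.
  move: kd; rewrite -subn_eq0 => /eqP ->; rewrite expr0 mulr1 normrM mulrC.
  by apply: ler_pM => //; [exact: altsum_bound|exact: boundA].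
have H0 : 0 <= H by exact: le_trans (hH 0%N isT).
have S0 : 0 <= S.
  by rewrite addr_ge0 ?(le_trans _ W0)// sumr_ge0// => j _; rewrite exprn_ge0.
have E i : h.[i%:R] * A (m.+1 + size s) (nseq m.+1 (Y i) ++ s) =
    \sum_(j < k.+1) (h * bin_poly j).[i%:R] *
      A (m + size (W j :: s)) (nseq m (Y i) ++ W j :: s).
  rewrite -addn1 nseqD -catA /= A_sum ?size_nseq ?addn1// mulr_sumr.
  apply: eq_bigr => j _; rewrite hornerM horner_bin_poly mulrA.
  by rewrite addSnnS.
rewrite (eq_altsum (fun i _ => E i)) altsum_sum.
apply: le_trans (ler_norm_sum _ _ _) _.
pose t j : R := if j is j'.+1 then sigma ^+ j'.+1 else eta.
have SE : S = \sum_(j < k.+1) t j by rewrite big_ord_recl.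
pose Q := 2 ^+ k * H * rho ^+ (k - d) * (K ^+ (m.+1 + size s).+1 * S ^+ m * \prod_(w <- s) `|w|).
rewrite [leRHS](_ : _ = \sum_(j < k.+1) Q * t j); last first.
  rewrite -mulr_sumr -SE /Q (exprSr S).
  by move: (K ^+ _) (rho ^+ _) => KK r; ring.
apply: ler_sum => j _; have jk : (j <= k)%N by rewrite -ltnS.
apply: le_trans (IH (W j :: s) (d + j)%N _ (H * 'C(k, j)%:R) _ _ _) _.
- apply: (leq_trans (size_polyMleq _ _)).
  have := leq_add szh (size_bin_poly (R := R) j); rewrite addSn addnS.
  by case: (_ + _)%N.
- move=> i ik; rewrite hornerM horner_bin_poly normrM ler_pM ?hH//.
  by rewrite ger0_norm// ler_nat leq_bin2l.
- by rewrite /= W_le1.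
rewrite big_cons /Q addSnnS /=.
set P := \prod_(_ <- _) _.
have P0 : 0 <= P by rewrite prodr_ge0.
suff : 'C(k, j)%:R * `|W j| * rho ^+ (k - (d + j)) <= rho ^+ (k - d) * t j.
  move=> ineq; rewrite [leLHS](_ : _ = (2 ^+ k * H * (K ^+ (m + (size s).+1).+1 * S ^+ m * P)) *
    ('C(k, j)%:R * `|W j| * rho ^+ (k - (d + j)))); last by ring.
  rewrite [leRHS](_ : _ = (2 ^+ k * H * (K ^+ (m + (size s).+1).+1 * S ^+ m * P)) *
    (rho ^+ (k - d) * t j)); last by ring.
  by rewrite ler_wpM2l// !mulr_ge0 ?exprn_ge0.
case: {P P0 Q} (nat_of_ord j) jk => [_|j' jk].
  by rewrite bin0 mul1r addn0 mulrC ler_wpM2l ?exprn_ge0.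
apply: le_trans (_ : (rho * sigma) ^+ j'.+1 * rho ^+ (k - (d + j'.+1)) <= _).
  by rewrite ler_wpM2r ?exprn_ge0// WS.
rewrite exprMn mulrAC -exprD /t ler_wpM2r ?exprn_ge0// ler_wiXn2l//.
by lia.
Qed.

Lemma altsum_series_bound (phi : nat -> R) : K * S <= 2^-1 ->
  (forall i, (i <= k)%N -> series (fun m => A m (nseq m (Y i))) @ \oo --> phi i) ->
  `|altsum k phi| <= 2 * K * (2 * rho) ^+ k.
Proof.
move=> KS cvgphi.
have S0 : 0 <= S.
  by rewrite addr_ge0 ?(le_trans _ W0)// sumr_ge0// => j _; rewrite exprn_ge0.
have cvgn := cvg_norm (@cvg_altsum _ _ _ _ k
  (fun n i => series (fun m => A m (nseq m (Y i))) n) phi cvgphi).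
apply: (cvgr_to_le (cvgn _ _)); near=> n.
have -> : altsum k (fun i => series (fun m => A m (nseq m (Y i))) n) =
    \sum_(m < n) altsum k (fun i => A m (nseq m (Y i))).
  by rewrite -altsum_sum; apply: eq_altsum => i _; rewrite /series/= big_mkord.
apply: le_trans (ler_norm_sum _ _ _) _.
(* The m-th term is at most K (2 rho)^k (K S)^m, and K S <= 1/2. *)
apply: le_trans (_ : \sum_(m < n) (K * (2 * rho) ^+ k) * 2^-1 ^+ m <= _).
  apply: ler_sum => m _.
  have := @term_bound m [::] 0 1 1; rewrite size_poly1 /= big_nil addn0 mulr1 subn0.
  under eq_altsum do rewrite hornerC mul1r cats0.
  move=> /(_ isT _ isT) H; apply: le_trans (H _) _ => [i _|].
    by rewrite hornerC normr1.
  rewrite mulr1 -exprMn exprS -mulrA -exprMn mulrA [_ * K]mulrC ler_wpM2l//.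
    by rewrite mulr_ge0 ?exprn_ge0 ?mulr_ge0.
  by rewrite lerXn2r ?nnegrE ?mulr_ge0.
rewrite -mulr_sumr -(big_mkord xpredT (fun m => 2^-1 ^+ m)).
rewrite -[leRHS]mulrA [leRHS]mulrC ler_wpM2l//.
  by rewrite mulr_ge0 ?exprn_ge0 ?mulr_ge0.
apply: le_trans (_ : series (geometric 1 2^-1) n <= _).
  by rewrite /series /=; under [leRHS]eq_bigr do rewrite mul1r.
apply: le_trans (geometric_le_lim _ ler01 _ _) _; first by lra.
  by rewrite ger0_norm; lra.
by rewrite mul1r [X in X^-1](_ : _ = 2^-1) ?invrK//; lra.
Unshelve. all: by end_near.
Qed.

End CauchyEstimate.

Lemma ffact_leq_exp n m : (n ^_ m <= n ^ m)%N.
Proof.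
elim: m => [|m IH]; first by rewrite ffactn0.
by rewrite ffactnSr expnSr leq_mul// leq_subr.
Qed.

(** A substitute for Stirling's formula: n^n <= (2n)! / n! = 'C(2n, n) n!, and the binomial
    coefficient is at most 2^(2n). *)
Lemma expn_leq_fact n : (n ^ n <= 4 ^ n * n`!)%N.
Proof.
have leff m : (n ^ m <= (n + m) ^_ m)%N.
  elim: m => [|m IH]; first by rewrite ffactn0.
  by rewrite addnS ffactnS expnS leq_mul//= (leqW (leq_addr _ _)).
apply: leq_trans (leff n) _; rewrite -bin_ffact leq_mul2r; apply/orP; right.
rewrite -[4%N]/(2 ^ 2)%N -expnM mul2n -addnn -[2%N]/(1 + 1)%N expnDn.
have lt_n : (n < (n + n).+1)%N by rewrite ltnS leq_addr.
by rewrite (bigD1 (Ordinal lt_n))//= !exp1n !mul1n ?muln1 leq_addr.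
Qed.

Section CauchyEstimateFact.
Context {R : realType} {X : normedModType R}.
Variables (A : nat -> seq X -> R) (K : R).
Hypothesis additiveA : forall m s1 s2 u v, (size s1 + size s2).+1 = m ->
  A m (s1 ++ (u + v) :: s2) = A m (s1 ++ u :: s2) + A m (s1 ++ v :: s2).
Hypothesis boundA : forall m s, size s = m -> all (fun w => `|w| <= 1) s ->
  `|A m s| <= K ^+ m.+1 * \prod_(w <- s) `|w|.

(** The choice rho = k C tau / sigma works because 'C(k, j) j! is a falling factorial, at most k^j.
    The bound then contains k^k, which becomes 4^k k!; with the 2^k of the alternating sum this
    gives the 8. *)
Lemma altsum_series_fact_bound (W : nat -> X) (k : nat) (eta sigma C tau : R)
    (phi : nat -> R) :
  0 <= K -> 0 < sigma -> sigma <= 2^-1 -> 0 <= C -> 0 <= tau ->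
  k%:R * C * tau <= sigma -> K * (eta + 2 * sigma) <= 2^-1 -> eta <= 1 ->
  `|W 0%N| <= eta ->
  (forall j, (0 < j <= k)%N -> `|W j| <= tau ^+ j * j`!%:R * C ^+ j) ->
  (forall i, (i <= k)%N ->
    series (fun m => A m (nseq m (\sum_(j < k.+1) W j *+ 'C(i, j)))) @ \oo --> phi i) ->
  `|altsum k phi| <= tau ^+ k * k`!%:R * (2 * K * (8 * C / sigma) ^+ k).
Proof.
move=> K0 sigma0 sigma12 C0 tau0 kCtau Ksmall eta1 W0 WS cvgphi.
pose rho := k%:R * C * tau / sigma.
have rho0 : 0 <= rho by rewrite divr_ge0 ?mulr_ge0// ltW.
apply: (le_trans (@altsum_series_bound _ _ A K additiveA boundA W k eta sigma rho _ _ _ _ _ _ _ _ phi _ _)) => //.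
- by rewrite ler_pdivrMr// mul1r.
- exact: ltW.
- lra.
- move=> j /andP[j0 jk].
  rewrite mulfVK ?gt_eqF//.
  apply: le_trans (ler_wpM2l _ (WS j _)) _; rewrite ?j0//.
  rewrite [leLHS](_ : _ = ('C(k, j) * j`!)%:R * (C * tau) ^+ j); last first.
    by rewrite natrM exprMn; ring.
  rewrite -[in leRHS]mulrA [leRHS]exprMn ler_wpM2r ?exprn_ge0 ?mulr_ge0//.
  by rewrite bin_ffact -natrX ler_nat ffact_leq_exp.
- apply: le_trans Ksmall; rewrite ler_wpM2l// lerD2l.
  apply: le_trans (_ : series (geometric sigma sigma) k <= _).
    by rewrite /series /= big_mkord; apply: ler_sum => j _; rewrite exprS.
  apply: le_trans (geometric_le_lim _ _ _ _) _; [exact: ltW|by []|rewrite ger0_norm; lra|].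
  by rewrite ler_pdivrMr; nra.
rewrite [leRHS](_ : _ = 2 * K * (tau ^+ k * k`!%:R * (8 * C / sigma) ^+ k)); last by ring.
rewrite ler_wpM2l ?mulr_ge0//.
rewrite [leLHS](_ : _ = (2 * C * tau / sigma) ^+ k * (k ^ k)%:R); last first.
  by rewrite natrX -exprMn /rho; congr (_ ^+ _); ring.
apply: le_trans (_ : (2 * C * tau / sigma) ^+ k * (4 ^ k * k`!)%:R <= _).
  by rewrite ler_wpM2l ?exprn_ge0 ?divr_ge0 ?mulr_ge0 ?(ltW sigma0)// ler_nat expn_leq_fact.
rewrite natrM natrX [leLHS]mulrA -[in leLHS]exprMn [leRHS]mulrAC -[in leRHS]exprMn.
by rewrite le_eqVlt; apply/orP; left; apply/eqP; congr (_ ^+ _ * _); ring.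
Qed.

End CauchyEstimateFact.

(** * Real analytic functions of one variable *)

Section Towers.
Context {R : realType}.
Implicit Types (g F : R -> R) (D : nat -> R -> R) (a b t s x d M C tau : R).

Lemma mvt_le F F' a b M : a <= b ->
  (forall x, a <= x <= b -> is_derive x 1 F (F' x)) ->
  (forall x, a <= x <= b -> F' x <= M) ->
  F b - F a <= (b - a) * M.
Proof.
move=> ab dF F'M.
have [x||x xab ->] := MVT_segment ab (f := F) (df := F').
- by rewrite in_itv /= => /andP[/ltW ax /ltW xb]; apply: dF; rewrite ax xb.
- apply: derivable_within_continuous => x; rewrite in_itv /= => xab.
  by have [] := dF x xab.
by rewrite mulrC ler_wpM2l ?subr_ge0// F'M//; move: xab; rewrite in_itv.
Qed.

Lemma mvt_norm F F' a b M : a <= b ->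
  (forall x, a <= x <= b -> is_derive x 1 F (F' x)) ->
  (forall x, a <= x <= b -> `|F' x| <= M) ->
  `|F b - F a| <= (b - a) * M.
Proof.
move=> ab dF F'M; rewrite ler_norml; apply/andP; split; last first.
  by apply: (mvt_le ab dF) => x /F'M; rewrite ler_norml => /andP[].
rewrite lerNl.
rewrite (_ : - (F b - F a) = - F b - - F a); last by rewrite opprB opprK addrC.
apply: (@mvt_le (fun x => - F x) (fun x => - F' x)) => // x xab.
  by apply: is_deriveN; exact: dF.
by move/F'M : xab; rewrite ler_norml lerNl => /andP[].
Qed.

Lemma is_derive_affine F (p q x dF : R) : is_derive (p * x + q) 1 F dF ->
  is_derive x 1 (fun y => F (p * y + q)) (p * dF).
Proof.
move=> dFx; rewrite mulrC.
have dpq : is_derive x 1 (fun y => p * y + q) p.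
  by apply: is_derive_eq; rewrite addr0 -[RHS]mulr1.
exact: is_derive1_comp.
Qed.

Lemma is_derive_translate F (q x dF : R) : is_derive (x + q) 1 F dF ->
  is_derive x 1 (fun y => F (y + q)) dF.
Proof.
rewrite -{1}[x]mul1r => /is_derive_affine; rewrite mul1r.
by under eq_fun do rewrite mul1r.
Qed.

(** Towers [D] of successive derivatives are stable under shifts and subtraction. The induction
    passes to the tower D k (x + tau) - D k x on [a, b - tau], whose n-th entry the mean value
    theorem bounds by tau M. *)
Lemma fdiff_le n D a b tau M : 0 <= tau -> a + tau *+ n <= b ->
  (forall k x, a <= x <= b -> is_derive x 1 (D k) (D k.+1 x)) ->
  (forall x, a <= x <= b -> D n x <= M) ->
  fdiff (nseq n tau) (D 0%N) a <= tau ^+ n * M.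
Proof.
move=> tau0; elim: n D b M => [|n IH] D b M.
  by rewrite mulr0n addr0 expr0 mul1r /= => ab _; apply; rewrite lexx.
rewrite mulrSr addrA => anb dD DM.
rewrite [leLHS](_ : _ = fdiff (nseq n tau) (fun x => D 0%N (x + tau) - D 0%N x) a); last first.
  rewrite fdiffD fdiffN /=; congr (_ - _).
  under [in RHS]eq_fun do rewrite addrC.
  by rewrite (@fdiff_shift _ _ _ id)// map_id addrC.
rewrite exprSr -mulrA.
apply: (IH (fun k x => D k (x + tau) - D k x) (b - tau)).
- by rewrite lerBrDr.
- move=> k x /andP[ax xb].
  apply: is_deriveB; last by apply: dD; lra.
  by apply: is_derive_translate; apply: dD; lra.
- move=> x /andP[ax xb].
  have -> : tau * M = (x + tau - x) * M by rewrite addrAC subrr add0r.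
  apply: (@mvt_le _ (D n.+1)); first by rewrite lerDl.
    by move=> y /andP[xy yb]; apply: dD; lra.
  by move=> y /andP[xy yb]; apply: DM; lra.
Qed.

Lemma fdiff_norm n D a b tau M : 0 <= tau -> a + tau *+ n <= b ->
  (forall k x, a <= x <= b -> is_derive x 1 (D k) (D k.+1 x)) ->
  (forall x, a <= x <= b -> `|D n x| <= M) ->
  `|fdiff (nseq n tau) (D 0%N) a| <= tau ^+ n * M.
Proof.
move=> tau0 anb dD DM; rewrite ler_norml; apply/andP; split; last first.
  by apply: (fdiff_le tau0 anb dD) => x /DM; rewrite ler_norml => /andP[].
rewrite lerNl -fdiffN.
apply: (fdiff_le (D := fun k x => - D k x) tau0 anb) => [k x xab|x /DM].
  by apply: is_deriveN; exact: dD.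
by rewrite ler_norml lerNl => /andP[].
Qed.

Lemma is_derive1n g k x : derivable (derive1n k g) x 1 ->
  is_derive x 1 (derive1n k g) (derive1n k.+1 g x).
Proof. by move=> dg; rewrite derive1nS derive1E; exact: derivableP. Qed.

(** Openness matters since [derive1n k.+1] at a point depends on [derive1n k] around it. *)
Lemma tower_derive1n (A : set R) D g : open A ->
  (forall x, A x -> D 0%N x = g x) ->
  (forall k x, A x -> is_derive x 1 (D k) (D k.+1 x)) ->
  forall k x, A x -> derivable (derive1n k g) x 1 /\ derive1n k g x = D k x.
Proof.
move=> oA D0 dD.
have main k : (forall x, A x -> derive1n k g x = D k x) ->
    forall x, A x -> is_derive x 1 (derive1n k g) (D k.+1 x).
  move=> gD x Ax; apply: near_eq_is_derive (dD k x Ax); near=> y.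
  by rewrite gD//; near: y; exact: open_nbhs_nbhs.
have gD k : forall x, A x -> derive1n k g x = D k x.
  elim: k => [|k IH] x Ax; first by rewrite derive1n0 D0.
  rewrite derive1nS derive1E; apply: derive_val; exact: main.
by move=> k x Ax; split; [have [] := main k (gD k) x Ax|exact: gD].
Unshelve. all: by end_near.
Qed.

End Towers.

Section Analytic.
Context {R : realType}.
Implicit Types (g : R -> R) (D : nat -> R -> R) (a : R^nat) (t s x d M C B : R).

Lemma natr_le_exp2 n : n%:R <= 2 ^+ n :> R.
Proof. by rewrite -natrX ler_nat ltnW// ltn_expl. Qed.

Lemma near_dist_lt t d : 0 < d -> \forall s \near t, `|s - t| < d.
Proof.
by move=> d0; apply/nbhs_ballP; exists d => // s /=; rewrite /ball/= distrC.
Qed.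

Lemma mvt_norm_sym (F F' : R -> R) x y M :
  (forall z, `|z - y| <= `|x - y| -> is_derive z 1 F (F' z)) ->
  (forall z, `|z - y| <= `|x - y| -> `|x - z| <= `|x - y| -> `|F' z| <= M) ->
  `|F x - F y| <= `|x - y| * M.
Proof.
move=> dF F'M; have [xy|/ltW yx] := leP x y.
  rewrite distrC (distrC x y) (@ger0_norm _ (y - x)) ?subr_ge0//; apply: (@mvt_norm _ F F') => // z /andP[xz zy].
    by apply: dF; rewrite !ler0_norm; lra.
  by apply: F'M; rewrite !ler0_norm; lra.
rewrite (@ger0_norm _ (x - y)) ?subr_ge0//.
apply: (@mvt_norm _ F F') => // z /andP[xz zy].
  by apply: dF; rewrite !ger0_norm; lra.
by apply: F'M; rewrite !ger0_norm; lra.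
Qed.

Lemma is_derive_exp g n x dg : is_derive x 1 g dg ->
  is_derive x 1 (fun y => g y ^+ n) (n%:R * g x ^+ n.-1 * dg).
Proof.
by move=> /(is_deriveX n); rewrite (_ : g ^+ n = fun y => g y ^+ n)// exprfctE.
Qed.

(* Lagrange: differentiate the Taylor polynomial with respect to its center. *)
Lemma taylor_bound D d t n s B : `|s - t| < d ->
  (forall k x, `|x - t| < d -> is_derive x 1 (D k) (D k.+1 x)) ->
  (forall x, `|x - t| < d -> `|D n.+1 x| <= B) ->
  `|D 0%N s - \sum_(k < n.+1) D k t / k`!%:R * (s - t) ^+ k| <=
  B * `|s - t| ^+ n.+1 / n`!%:R.
Proof.
move=> std dD DB.
pose G x := \sum_(k < n.+1) D k x / k`!%:R * (s - x) ^+ k.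
have -> : D 0%N s = G s.
  rewrite /G big_ord_recl big1 ?addr0 ?expr0 ?mulr1 ?divr1// => i _.
  by rewrite subrr expr0n /= mulr0.
have dG x : `|x - t| < d -> is_derive x 1 G (D n.+1 x / n`!%:R * (s - x) ^+ n).
  move=> xt; rewrite /G; elim: n {DB G} => [|n IH].
    under eq_fun do rewrite big_ord1 expr0 mulr1 divr1.
    by rewrite expr0 mulr1 divr1; exact: dD.
  under eq_fun do rewrite big_ord_recr /=.
  have dx : is_derive x 1 (fun y => s - y) (-1).
    by apply: is_derive_eq; rewrite add0r mul1r.
  have dDx := dD n.+1 x xt.
  have dDc : is_derive x 1 (fun y => D n.+1 y / n.+1`!%:R) (D n.+2 x / n.+1`!%:R).
    under eq_fun do rewrite mulrC.
    by apply: is_derive_eq; rewrite /GRing.scale /= mulrC.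
  have H := is_deriveD IH (is_deriveM dDc (is_derive_exp n.+1 dx)).
  apply: (is_derive_eq H).
  rewrite /GRing.scale /= factS natrM; field.
  by rewrite nat1r !pnatr_eq0 -!lt0n fact_gt0.
apply: le_trans (mvt_norm_sym (F' := fun x => D n.+1 x / n`!%:R * (s - x) ^+ n) (M := B * `|s - t| ^+ n / n`!%:R) _ _) _.
- by move=> z zs; apply: dG; exact: le_lt_trans zs std.
- move=> z zs sz; rewrite normrM normrX normf_div (@ger0_norm _ n`!%:R)// mulrAC.
  rewrite ler_wpM2r ?invr_ge0// ler_pM ?exprn_ge0//.
    by apply: DB; exact: le_lt_trans zs std.
  by rewrite lerXn2r ?nnegrE.
by rewrite exprS le_eqVlt; apply/orP; left; apply/eqP; ring.
Qed.

Lemma tower_taylor D t d M C : 0 < d -> 0 < C ->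
  (forall k x, `|x - t| < d -> is_derive x 1 (D k) (D k.+1 x)) ->
  (forall k x, `|x - t| < d -> `|D k x| <= M * C ^+ k * k`!%:R) ->
  \forall s \near t, pseries (fun k => D k t / k`!%:R) (s - t) @ \oo --> D 0%N s.
Proof.
move=> d0 C0 dD DM.
have M0 : 0 <= M.
  have := DM 0%N t; rewrite subrr normr0 => /(_ d0).
  by rewrite expr0 fact0 !mulr1; exact: le_trans.
near=> s.
have std : `|s - t| < d by near: s; apply: near_dist_lt; rewrite ?invr_gt0 ?mulr_gt0.
(* The remainder M n (C |s - t|)^n has a factor n, absorbed by 2^n; hence 4 and not 2. *)
have sC : `|s - t| < (4 * C)^-1 by near: s; apply: near_dist_lt; rewrite ?invr_gt0 ?mulr_gt0.
apply/cvgrPdist_le => e e0; near=> n.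
have n0 : (0 < n)%N by near: n; exists 1%N.
rewrite /pseries /series /= big_mkord -(prednK n0).
apply: le_trans (taylor_bound std dD (DM n.-1.+1)) _; rewrite (prednK n0).
have -> : n`! = (n * n.-1`!)%N by rewrite -{1}(prednK n0) factS (prednK n0).
rewrite natrM [leLHS](_ : _ = M * (n%:R * (C * `|s - t|) ^+ n)); last first.
  by rewrite exprMn; field; rewrite pnatr_eq0 -lt0n fact_gt0.
apply: le_trans (_ : M * 2^-1 ^+ n <= _).
  rewrite ler_wpM2l//; apply: le_trans (_ : 2 ^+ n * 4^-1 ^+ n <= _).
    rewrite ler_pM ?natr_le_exp2 ?exprn_ge0 ?mulr_ge0 ?(ltW C0)//.
    rewrite lerXn2r ?nnegrE ?mulr_ge0 ?(ltW C0)//.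
    by rewrite -ler_pdivlMl// mulrC -invfM ltW.
  by rewrite -exprMn [X in X ^+ n](_ : _ = 2^-1)//; lra.
near: n; apply: (@cvgr_le _ _ _ _ (geometric M 2^-1) 0) => //.
by apply: (@cvg_geometric R M 2^-1); rewrite ger0_norm; lra.
Unshelve. all: by end_near.
Qed.

Lemma tower_analytic D t d M C : 0 < d -> 0 < C ->
  (forall k x, `|x - t| < d -> is_derive x 1 (D k) (D k.+1 x)) ->
  (forall k x, `|x - t| < d -> `|D k x| <= M * C ^+ k * k`!%:R) ->
  analytic_at (D 0%N) t.
Proof.
by move=> d0 C0 dD DM; exists (fun k => D k t / k`!%:R); exact: tower_taylor dD DM.
Qed.

Lemma series_geometric_bound (u : R^nat) B : (forall n, `|u n| <= B * 2^-1 ^+ n) ->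
  cvgn (series u) /\ `|limn (series u)| <= 2 * B.
Proof.
move=> uB; have B0 : 0 <= B by have := uB 0%N; rewrite expr0 mulr1; exact: le_trans.
have cgeo : cvgn (series (geometric B 2^-1)).
  by apply: is_cvg_geometric_series; rewrite ger0_norm; lra.
have cu : cvgn [normed series u].
  by apply: series_le_cvg cgeo => // n; rewrite /= ?mulr_ge0 ?exprn_ge0.
split; first exact: normed_cvg.
apply: le_trans (lim_series_norm cu) _.
apply: limr_le => //; near=> n.
apply: le_trans (_ : series (geometric B 2^-1) n <= _).
  by rewrite /series /=; apply: ler_sum => i _; exact: uB.
apply: le_trans (geometric_le_lim _ _ _ _) _ => //; first by rewrite ger0_norm; lra.
by rewrite [X in X^-1](_ : _ = 2^-1) ?invrK; lra.
Unshelve. all: by end_near.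
Qed.

Lemma iter_pseries_diffs a k n :
  iter k (@pseries_diffs R) a n = ((n + k) ^_ k)%:R * a (n + k)%N.
Proof.
elim: k n => [|k IH] n; first by rewrite ffactn0 mul1r addn0.
rewrite iterS {1}/pseries_diffs IH addSnnS mulrA -natrM mulnC; congr (_%:R * _).
by rewrite ffactnSr addnS subSn ?leq_addl// addnK.
Qed.

Lemma pseries_tower_bound a M C k x : 0 <= M -> 0 < C ->
  (forall n, `|a n| <= M * C ^+ n) -> `|x| <= (4 * C)^-1 ->
  cvgn (pseries (iter k (@pseries_diffs R) a) x) /\
  `|limn (pseries (iter k (@pseries_diffs R) a) x)| <= 2 * M * (2 * C) ^+ k * k`!%:R.
Proof.
move=> M0 C0 aM xC.
have [n|? H] := @series_geometric_bound (fun n => iter k (@pseries_diffs R) a n * x ^+ n)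
  (M * (2 * C) ^+ k * k`!%:R); last by split => //; rewrite -!mulrA in H *.
rewrite iter_pseries_diffs normrM normrX normrM ger0_norm// -bin_ffact natrM.
(* The 2^n lost here is the reason for restricting to |x| <= 1/(4 C), which leaves 2^-n. *)
have bin_le : 'C(n + k, k)%:R <= 2 ^+ (n + k) :> R.
  rewrite -natrX ler_nat -[2%N]/(1 + 1)%N expnDn.
  have lt_k : (k < (n + k).+1)%N by rewrite ltnS leq_addl.
  by rewrite (bigD1 (Ordinal lt_k))//= !exp1n !mul1n ?muln1 leq_addr.
apply: le_trans (_ : (2 ^+ (n + k) * k`!%:R) * (M * C ^+ (n + k)) * (4 * C)^-1 ^+ n <= _).
  rewrite ler_pM ?mulr_ge0 ?exprn_ge0//; last by rewrite lerXn2r ?nnegrE// (le_trans _ xC).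
  by rewrite ler_pM ?mulr_ge0// ler_wpM2r.
rewrite !exprD !exprVn !exprMn -(exprVn 2) [leRHS](_ : _ = M * 2 ^+ k * C ^+ k * k`!%:R * (2 ^+ n)^-1).
  rewrite -[4]/(2 * 2)%:R natrM exprMn le_eqVlt; apply/orP; left; apply/eqP.
  by field; rewrite !expf_neq0 ?gt_eqF.
by rewrite exprVn; ring.
Qed.

Lemma pseries_analytic a t g M C d : 0 <= M -> 0 < C -> 0 < d -> d <= (4 * C)^-1 ->
  (forall n, `|a n| <= M * C ^+ n) ->
  (forall s, `|s - t| < d -> pseries a (s - t) @ \oo --> g s) ->
  forall k s, `|s - t| < d -> derivable (derive1n k g) s 1 /\
    `|derive1n k g s| <= 2 * M * (2 * C) ^+ k * k`!%:R.
Proof.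
move=> M0 C0 d0 dC aM ag.
pose D k x := limn (pseries (iter k (@pseries_diffs R) a) (x - t)).
have oA : open [set s | `|s - t| < d].
  rewrite openE => s /= std; rewrite /interior.
  near=> z; apply: le_lt_trans (_ : `|z - s| + `|s - t| < d).
    by rewrite (le_trans _ (ler_normD _ _))// addrA subrK.
  by rewrite -ltrBrDr; near: z; apply: near_dist_lt; rewrite subr_gt0.
have dD k s : `|s - t| < d -> is_derive s 1 (D k) (D k.+1 s).
  move=> st; apply: (@is_derive_translate _ (fun x => limn (pseries _ x))).
  have c0 : 0 < (4 * C)^-1 by rewrite invr_gt0 mulr_gt0.
  have cn : `|(4 * C)^-1| <= (4 * C)^-1 by rewrite gtr0_norm.
  rewrite /D iterS; apply: (@pseries_snd_diffs R _ (4 * C)^-1).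
  - exact: (pseries_tower_bound k M0 C0 aM cn).1.
  - by have := (pseries_tower_bound k.+1 M0 C0 aM cn).1; rewrite iterS.
  - by have := (pseries_tower_bound k.+2 M0 C0 aM cn).1; rewrite !iterS.
  - by rewrite (gtr0_norm c0) (lt_le_trans st).
have D0 s : `|s - t| < d -> D 0%N s = g s.
  by move=> st; apply: cvg_lim => //; exact: ag.
move=> k s st; have [dk ->] := tower_derive1n oA D0 dD k st; split => //.
by apply: (pseries_tower_bound k M0 C0 aM _).2; rewrite ltW// (lt_le_trans st).
Unshelve. all: by end_near.
Qed.

(** Unlike a series centred at [t], bounds of Cauchy type speak about all points near [t] at once,
    and they are what differences can be compared with. *)
Lemma analytic_atP g t : analytic_at g t <->
  exists M C d, [/\ 0 <= M, 0 < C, 0 < d & forall k s, `|s - t| < d ->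
    derivable (derive1n k g) s 1 /\ `|derive1n k g s| <= M * C ^+ k * k`!%:R].
Proof.
split=> [|[M [C [d [M0 C0 d0 H]]]]]; last first.
  apply: (@tower_analytic (fun k => derive1n k g) t d M C) => // k x xd.
    by apply: is_derive1n; exact: (H k x xd).1.
  exact: (H k x xd).2.
move=> [a /nbhs_ballP[d /= d0 ag]].
pose h := d / 2; have h0 : 0 < h by rewrite divr_gt0.
(* The terms of the series converging at t + h are bounded. *)
have [M M0 aM] : exists2 M, 0 <= M & forall n, `|a n| <= M * h^-1 ^+ n.
  have /ag : ball t d (h + t).
    by rewrite /ball /= opprD addrCA subrr addr0 normrN gtr0_norm//; rewrite /h; lra.
  rewrite addrK => /cvgP/cvg_series_bounded[N [Nreal NM]].
  have N1 : N < `|N| + 1 by rewrite (le_lt_trans (ler_norm _))// ltrDl.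
  exists (`|N| + 1) => [|n]; first by rewrite addr_ge0.
  have /= := NM _ N1 n I; rewrite normrM normrX (gtr0_norm h0) exprVn.
  by rewrite ler_pdivlMr ?exprn_gt0.
pose e := Num.min d (4 * h^-1)^-1.
have e0 : 0 < e by rewrite lt_min d0 invr_gt0 mulr_gt0// invr_gt0.
have H := @pseries_analytic a t g M h^-1 e M0 _ e0 _ aM.
exists (2 * M), (2 * h^-1), e; split; rewrite ?mulr_ge0 ?mulr_gt0 ?invr_gt0//.
apply: H; rewrite ?invr_gt0//; first by rewrite ge_min lexx orbT.
move=> s; rewrite lt_min => /andP[sd _]; apply: ag.
by rewrite /ball /= distrC.
Qed.

Lemma analytic_at_taylor g t : analytic_at g t ->
  \forall s \near t, pseries (fun k => derive1n k g t / k`!%:R) (s - t) @ \oo --> g s.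
Proof.
move=> /analytic_atP[M [C [d [M0 C0 d0 H]]]].
apply: (tower_taylor (D := fun k => derive1n k g) d0 C0) => k x xd.
  by apply: is_derive1n; exact: (H k x xd).1.
exact: (H k x xd).2.
Qed.

Lemma analytic_at_taylor_bound g t m : analytic_at g t ->
  exists B d, 0 < d /\ forall s, `|s - t| < d ->
  `|g s - \sum_(k < m.+1) derive1n k g t / k`!%:R * (s - t) ^+ k| <=
  B * `|s - t| ^+ m.+1.
Proof.
move=> /analytic_atP[M [C [d [M0 C0 d0 H]]]].
exists (M * C ^+ m.+1 * m.+1`!%:R / m`!%:R), d; split => // s sd.
rewrite [leRHS]mulrAC.
apply: (taylor_bound (D := fun k => derive1n k g) sd) => [k x xd|x xd].
  by apply: is_derive1n; exact: (H k x xd).1.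
exact: (H m.+1 x xd).2.
Qed.

Lemma analytic_atB g1 g2 t : analytic_at g1 t -> analytic_at g2 t ->
  analytic_at (fun s => g1 s - g2 s) t.
Proof.
move=> [a ag] [b bg]; exists (fun k => a k - b k).
near=> s.
rewrite (_ : pseries _ _ = pseries a (s - t) - pseries b (s - t)).
  by apply: cvgB; near: s.
apply/funext => n; rewrite /pseries /series /=.
by under eq_bigr do rewrite mulrBl; rewrite sumrB.
Unshelve. all: by end_near.
Qed.

(** Smallness is asked only for some arbitrarily small h, because one of the later estimates is
    available only for special h. Letting h tend to 0 kills [b 0]; dividing by h then lowers m. *)
Lemma poly_small_eq0 (b : R^nat) m :
  (forall e : R, 0 < e -> exists h : R, [/\ 0 < h, h < e &
    `|\sum_(j < m.+1) b j * h ^+ j| <= e * h ^+ m]) ->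
  forall j, (j <= m)%N -> b j = 0.
Proof.
elim: m b => [|m IH] b small.
  move=> j; rewrite leqn0 => /eqP ->; apply/eqP/contraT; rewrite -normr_gt0 => b0.
  have [|h [_ _]] := small (`|b 0%N| / 2); first by rewrite divr_gt0.
  by rewrite big_ord1 !expr0 !mulr1; lra.
have b0 : b 0%N = 0.
  apply/eqP/contraT; rewrite -normr_gt0 => b0.
  pose S := \sum_(j < m.+1) `|b j.+1|.
  have S0 : 0 <= S by rewrite sumr_ge0.
  have S1 : 0 < 2 * (1 + S) by rewrite mulr_gt0// ltr_pwDl.
  have [|h [h0]] := small (Num.min 1 (`|b 0%N| / (2 * (1 + S)))).
    by rewrite lt_min ltr01 divr_gt0.
  rewrite lt_min. move=> /andP[h1 hb] hsmall.
  suff : `|b 0%N| <= h * S + `|b 0%N| / (2 * (1 + S)).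
    have : h * (1 + S) < `|b 0%N| / 2.
      have -> : `|b 0%N| / 2 = `|b 0%N| / (2 * (1 + S)) * (1 + S).
        by field; rewrite gt_eqF// ltr_pwDl.
      by rewrite ltr_pM2r// ltr_pwDl.
    have : `|b 0%N| / (2 * (1 + S)) <= `|b 0%N| / 2.
      by rewrite ler_wpM2l// lef_pV2 ?posrE//; nra.
    have : 0 <= h * S by rewrite mulr_ge0// ltW.
    nra.
  rewrite [X in `|X| <= _](_ : _ = \sum_(j < m.+2) b j * h ^+ j - \sum_(j < m.+1) b j.+1 * h ^+ j.+1); last first.
    by rewrite big_ord_recl /= expr0 mulr1 addrK.
  apply: le_trans (ler_normB _ _) _; rewrite addrC lerD//.
    apply: le_trans (ler_norm_sum _ _ _) _; rewrite mulr_sumr; apply: ler_sum => j _.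
    rewrite normrM mulrC ler_wpM2r// normrX (gtr0_norm h0) exprS ler_piMr ?(ltW h0)//.
    by rewrite exprn_ile1// ltW.
  apply: le_trans hsmall _; apply: le_trans (_ : Num.min 1 (`|b 0%N| / (2 * (1 + S))) * 1 <= _).
    rewrite ler_wpM2l ?exprn_ile1 ?(ltW h0) ?(ltW h1)//.
    by rewrite le_min ler01 divr_ge0// ltW.
  by rewrite mulr1 ge_min lexx orbT.
case=> [//|j] jm; apply: (IH (fun j => b j.+1)) => // e e0.
have [h [h0 he hs]] := small e e0; exists h; split => //.
move: hs; rewrite big_ord_recl b0 mul0r add0r.
under eq_bigr do rewrite lift0 exprS mulrCA.
by rewrite -mulr_sumr normrM (gtr0_norm h0) exprS mulrCA ler_pM2l.
Qed.

(** Let [tau] be the supremum of the times up to which [g] vanishes. The Taylor coefficients at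
    [tau] vanish, hence so does [g] around [tau], which contradicts the supremum unless tau = 1. *)
Lemma analytic_identity g : (forall t, 0 <= t <= 1 -> analytic_at g t) ->
  (exists2 d, 0 < d & forall s, 0 <= s < d -> g s = 0) -> g 1 = 0.
Proof.
move=> ag [d d0 gd].
pose S := [set t | 0 <= t <= 1 /\ forall s, 0 <= s < t -> g s = 0].
have Sd : S (Num.min d 1).
  split; first by rewrite le_min (ltW d0) ler01 ge_min lexx orbT.
  by move=> s; rewrite lt_min => /and3P[s0 sd _]; rewrite gd// s0.
have supS : has_sup S.
  by split; [exists (Num.min d 1)|exists 1 => t [/andP[]]].
pose tau := sup S.
have tau0 : 0 < tau.
  apply: lt_le_trans (_ : Num.min d 1 <= _); first by rewrite lt_min d0 ltr01.
  by apply: sup_upper_bound.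
have tau1 : tau <= 1 by apply: ge_sup => [|t [/andP[]]//]; exists (Num.min d 1).
have gtau s : 0 <= s < tau -> g s = 0.
  move=> /andP[s0 st]; have s_lt : 0 < tau - s by rewrite subr_gt0.
  have [t [_ gt]] := sup_adherent s_lt supS.
  by rewrite opprB addrCA subrr addr0 => stt; apply: gt; rewrite s0.
have atau : analytic_at g tau by apply: ag; rewrite (ltW tau0).
have dtau k : derive1n k g tau / k`!%:R = 0.
  have [B [r [r0 HB]]] := analytic_at_taylor_bound k atau.
  have H := @poly_small_eq0 (fun j => derive1n j g tau / j`!%:R * (-1) ^+ j) k.
  (* Zeros are known only to the left of [tau], so the Taylor polynomial is tested at tau - h; hence
     the signs. *)
  suff : derive1n k g tau / k`!%:R * (-1) ^+ k = 0.
    by move=> /eqP; rewrite mulf_eq0 signr_eq0 orbF => /eqP.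
  apply: (@poly_small_eq0 (fun j => derive1n j g tau / j`!%:R * (-1) ^+ j) k _ k) => // e e0.
  have B1 : 0 < 2 * (`|B| + 1) by rewrite mulr_gt0// ltr_wpDl.
  pose h := Num.min (Num.min (e / 2) (r / 2)) (Num.min (tau / 2) (e / (2 * (`|B| + 1)))).
  have h0 : 0 < h by rewrite !lt_min !divr_gt0.
  have : h <= h by []; rewrite {2}/h !le_min => /andP[/andP[he hr] /andP[ht hB]].
  exists h; split => //; first lra.
  have /HB : `|(tau - h) - tau| < r by rewrite addrAC subrr add0r normrN gtr0_norm//; lra.
  rewrite gtau; last by apply/andP; split; lra.
  rewrite sub0r normrN addrAC subrr add0r normrN (gtr0_norm h0).
  under eq_bigr do rewrite exprNn mulrA.
  move=> /le_trans; apply; rewrite exprS mulrA ler_wpM2r ?exprn_ge0 ?(ltW h0)//.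
  apply: le_trans (_ : (`|B| + 1) * h <= _).
    by rewrite ler_wpM2r ?(ltW h0)// (le_trans (ler_norm _))// lerDl.
  move: hB; rewrite ler_pdivlMr// => hB.
  have : 0 <= h * (`|B| + 1) by rewrite mulr_ge0 ?(ltW h0)// addr_ge0.
  lra.
have /nbhs_ballP[r /= r0 Hr] := analytic_at_taylor atau.
have gr s : `|s - tau| < r -> g s = 0.
  move=> sr; have /Hr : ball tau r s by rewrite /ball /= distrC.
  have -> : pseries (fun k => derive1n k g tau / k`!%:R) (s - tau) = fun=> 0.
    by apply/funext => n; rewrite /pseries /series /= big1// => i _; rewrite dtau mul0r.
  move=> /cvg_lim <-//; exact: lim_cst.
have : tau = 1.
  apply/eqP; rewrite eq_le tau1 /= leNgt; apply/negP => tau_lt1.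
  pose s := Num.min (tau + r / 2) 1.
  have s_tau : tau < s by rewrite lt_min tau_lt1 ltrDl divr_gt0.
  have : S s.
    split; first by rewrite (ltW (lt_trans tau0 s_tau)) ge_min lexx orbT.
    move=> z /andP[z0]; rewrite lt_min => /andP[zr _].
    have [zt|tz] := ltP z tau; first by rewrite gtau// z0.
    by apply: gr; rewrite ger0_norm; lra.
  by move=> /(sup_upper_bound supS); rewrite leNgt s_tau.
by move=> tauE; rewrite gr// tauE subrr normr0.
Qed.

(** Analyticity on [0, 1] does not make the Taylor series at 0 converge at 1; the coefficient bound
    does. With C <= 1/8 the sum is analytic on |s| < 2, around the whole segment, so the identity
    theorem applies to its difference with [g]. *)
Lemma analytic_sum g M C : (forall t, 0 <= t <= 1 -> analytic_at g t) ->
  0 <= M -> 0 < C -> C <= 8^-1 ->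
  (forall k, `|derive1n k g 0 / k`!%:R| <= M * C ^+ k) ->
  series (fun k => derive1n k g 0 / k`!%:R) @ \oo --> g 1.
Proof.
move=> ag M0 C0 C8 gM.
pose a k := derive1n k g 0 / k`!%:R.
have C4 : 2 <= (4 * C)^-1.
  rewrite -[2]invrK lef_pV2 ?posrE ?invr_gt0 ?mulr_gt0//; lra.
have ca s : `|s| < 2 -> cvgn (pseries a s).
  move=> s2; apply: (@pseries_tower_bound a M C 0 s M0 C0 gM _).1.
  exact: le_trans (ltW s2) C4.
pose g2 s := limn (pseries a s).
have H := @pseries_analytic a 0 g2 M C 2 M0 C0 (ltr0Sn _ _) C4 gM.
have ag2 t : 0 <= t <= 1 -> analytic_at g2 t.
  move=> t01; apply/analytic_atP; exists (2 * M), (2 * C), 1; split; rewrite ?mulr_ge0 ?mulr_gt0//.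
  move=> k s st; apply: H; first by move=> z; rewrite subr0; exact: ca.
  rewrite subr0 -[s](subrK t); apply: le_lt_trans (ler_normD _ _) _.
  rewrite (@ger0_norm _ t); lra.
suff : g 1 - g2 1 = 0.
  move=> /eqP; rewrite subr_eq0 => /eqP ->.
  have := ca 1; rewrite normr1 => /(_ _); rewrite /g2.
  rewrite (_ : pseries a 1 = series a); last first.
    by apply/funext => n; rewrite /pseries /series /=; apply: eq_bigr => i _; rewrite expr1n mulr1.
  by apply; lra.
apply: (@analytic_identity (fun s => g s - g2 s)).
  by move=> t t01; apply: analytic_atB; [exact: ag|exact: ag2].
have a0 : analytic_at g 0 by apply: ag; rewrite lexx ler01.
have /nbhs_ballP[r /= r0 Hr] := analytic_at_taylor a0.
exists r => // s /andP[s0 sr]; apply/eqP; rewrite subr_eq0; apply/eqP/esym/cvg_lim => //.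
have /Hr : ball (0 : R) r s by rewrite /ball /= sub0r normrN ger0_norm.
by rewrite subr0.
Qed.

(** If D k x0 > B, then by continuity D k > B' > B just right of [x0], and every difference with
    small step would exceed tau^k B. *)
Lemma tower_le_fdiff D (k : nat) (x0 b : R) B : x0 < b ->
  (forall k x, x0 <= x <= b -> is_derive x 1 (D k) (D k.+1 x)) ->
  (forall e : R, 0 < e -> exists tau : R, [/\ 0 < tau, tau < e &
    fdiff (nseq k tau) (D 0%N) x0 <= tau ^+ k * B]) ->
  D k x0 <= B.
Proof.
move=> ab dD HB; rewrite leNgt; apply/negP => BD.
pose B' := (B + D k x0) / 2.
have cD : {for x0, continuous (D k)}.
  apply: differentiable_continuous; apply/derivable1_diffP.
  by have [] := dD k x0; rewrite // lexx ltW.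
have B'D : B' < D k x0 by rewrite /B'; lra.
have : \forall x \near x0, B' < D k x by exact: (cvgr_gt _ cD).
move=> /nbhs_ballP[e /= e0 He].
pose e' := Num.min (b - x0) (e / 2).
have e'0 : 0 < e' by rewrite lt_min subr_gt0 ab divr_gt0.
have [|tau [tau0 taue fB]] := HB (e' / k.+1%:R); first by rewrite divr_gt0.
have ktau : x0 + tau *+ k <= x0 + e'.
  rewrite lerD2l -mulr_natr; apply: le_trans (_ : tau * k.+1%:R <= _).
    by rewrite ler_wpM2l ?(ltW tau0)// ler_nat.
  by rewrite -ler_pdivlMr// ltW.
have : fdiff (nseq k tau) (fun x => - D 0%N x) x0 <= tau ^+ k * (- B').
  apply: (@fdiff_le _ k (fun k x => - D k x) x0 (x0 + e') tau _ (ltW tau0) ktau).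
    move=> j x /andP[ax xe]; apply: is_deriveN; apply: dD; rewrite ax/=.
    rewrite (le_trans xe)// -lerBrDl ge_min lexx//.
  move=> x /andP[ax xe]; rewrite lerN2 ltW//; apply: He.
  rewrite /ball /= distrC ger0_norm ?subr_ge0//.
  rewrite ltrBlDl (le_lt_trans xe)// ltrD2l gt_min; apply/orP; right; lra.
rewrite fdiffN mulrN lerN2 => /le_trans /(_ fB).
by rewrite ler_pM2l ?exprn_gt0// /B'; lra.
Qed.

(** The step may depend on [k] and [x]. Where the criterion fails, differences are therefore too
    large for all small steps, and a step suited to the order can be picked. *)
Lemma smooth_analytic g t M C d : smooth_fun g -> 0 <= M -> 0 < C -> 0 < d ->
  (forall k (x : R), `|x - t| < d -> forall e : R, 0 < e -> exists tau : R, [/\ 0 < tau, tau < e &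
    `|fdiff (nseq k tau) g x| <= tau ^+ k * (M * C ^+ k * k`!%:R)]) ->
  analytic_at g t.
Proof.
move=> sg M0 C0 d0 H; apply/analytic_atP; exists M, C, d; split => // k s sd.
split; first exact: sg.
have dg j x : is_derive x 1 (derive1n j g) (derive1n j.+1 g x).
  by apply: is_derive1n; exact: sg.
have s1 : s < s + 1 by rewrite ltrDl.
rewrite ler_norml; apply/andP; split; last first.
  apply: (@tower_le_fdiff (fun j => derive1n j g) k s _ _ s1) => // e e0.
  have [tau [t0 te ft]] := H k s sd e e0; exists tau; split => //.
  by apply: le_trans ft; exact: ler_norm.
rewrite lerNl; apply: (@tower_le_fdiff (fun j x => - derive1n j g x) k s _ _ s1) => // e e0.
have [tau [t0 te ft]] := H k s sd e e0; exists tau; split => //.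
by apply: le_trans ft; rewrite fdiffN -normrN; exact: ler_norm.
Qed.

End Analytic.

(** * Smooth functions and special curves *)

Section SmoothFunctions.
Context {R : realType}.
Implicit Types (f g : R -> R) (n : nat).

(** The recursion descends to the derivative, whereas [derive1n] differentiates last. Stability
    under products and composition then follows by induction, with no formula for higher
    derivatives. *)
Fixpoint differentiable_times n g : Prop :=
  if n is m.+1 then (forall t : R, derivable g t 1) /\ differentiable_times m (derive1 g)
  else True.

Lemma smooth_funP g : smooth_fun g <-> forall n, differentiable_times n g.
Proof.
split=> [sg n|dg n].
  elim: n g sg => //= n IH g sg; split; first exact: (sg 0%N).
  by apply: IH => m t; rewrite -derive1Sn; exact: sg.
elim: n g dg => [|n IH] g dg t; first exact: (dg 1%N).1.
by rewrite derive1Sn; apply: IH => m; exact: (dg m.+1).2.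
Qed.

Lemma differentiable_timesW n g : differentiable_times n.+1 g -> differentiable_times n g.
Proof.
by elim: n g => // n IH g [dg ddg]; split => //; apply: IH.
Qed.

Lemma derive1_funE f (df : R -> R) : (forall t : R, is_derive t 1 f (df t)) -> derive1 f = df.
Proof.
by move=> fdf; apply/funext => t; rewrite derive1E; exact: (@derive_val _ _ _ _ _ _ _ (fdf t)).
Qed.

Lemma derivable1P f : (forall t : R, derivable f t 1) ->
  forall t : R, is_derive t 1 f (derive1 f t).
Proof. by move=> df t; rewrite derive1E; exact: derivableP. Qed.

Lemma differentiable_timesD n f g : differentiable_times n f ->
  differentiable_times n g -> differentiable_times n (fun x => f x + g x).
Proof.
elim: n f g => // n IH f g [df ddf] [dg ddg].
have D (t : R) : is_derive t 1 (fun x => f x + g x) (derive1 f t + derive1 g t).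
  by apply: is_deriveD; exact: derivable1P.
by split=> [t|]; [have [] := D t|rewrite (derive1_funE D); exact: IH].
Qed.

Lemma differentiable_timesM n f g : differentiable_times n f ->
  differentiable_times n g -> differentiable_times n (fun x => f x * g x).
Proof.
elim: n f g => // n IH f g /[dup] /differentiable_timesW fn [df ddf].
move=> /[dup] /differentiable_timesW gn [dg ddg].
have D (t : R) : is_derive t 1 (fun x => f x * g x) (f t * derive1 g t + g t * derive1 f t).
  exact: (is_deriveM (derivable1P df t) (derivable1P dg t)).
split=> [t|]; first by have [] := D t.
by rewrite (derive1_funE D); apply: differentiable_timesD; exact: IH.
Qed.

Lemma differentiable_times_comp n f g : differentiable_times n f ->
  differentiable_times n g -> differentiable_times n (fun x => f (g x)).
Proof.
elim: n f g => // n IH f g [df ddf].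
move=> /[dup] /differentiable_timesW gn [dg ddg].
have D (t : R) : is_derive t 1 (fun x => f (g x)) (derive1 f (g t) * derive1 g t).
  exact: (is_derive1_comp (derivable1P df (g t)) (derivable1P dg t)).
split=> [t|]; first by have [] := D t.
by rewrite (derive1_funE D); apply: differentiable_timesM => //; exact: IH.
Qed.

Lemma smooth_funD f g : smooth_fun f -> smooth_fun g -> smooth_fun (fun x => f x + g x).
Proof.
by move=> /smooth_funP sf /smooth_funP sg; apply/smooth_funP => n; exact: differentiable_timesD.
Qed.

Lemma smooth_funM f g : smooth_fun f -> smooth_fun g -> smooth_fun (fun x => f x * g x).
Proof.
by move=> /smooth_funP sf /smooth_funP sg; apply/smooth_funP => n; exact: differentiable_timesM.
Qed.

Lemma smooth_fun_comp f g : smooth_fun f -> smooth_fun g -> smooth_fun (fun x => f (g x)).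
Proof.
by move=> /smooth_funP sf /smooth_funP sg; apply/smooth_funP => n; exact: differentiable_times_comp.
Qed.

Lemma smooth_tower (D : nat -> R -> R) :
  (forall k (x : R), is_derive x 1 (D k) (D k.+1 x)) -> smooth_fun (D 0%N).
Proof.
move=> dD k x; exact: (@tower_derive1n R setT D (D 0%N) openT (fun _ _ => erefl) (fun k x _ => dD k x) k x I).1.
Qed.

Lemma smooth_fun_cst (c : R) : smooth_fun (fun=> c).
Proof.
apply: (@smooth_tower (fun k => if k is 0%N then fun=> c else fun=> 0)) => -[|k] x;
  exact: is_derive_cst.
Qed.

Lemma smooth_fun_id : smooth_fun (@id R).
Proof.
apply: (@smooth_tower (fun k => match k with 0%N => id | 1%N => fun=> 1 | _ => fun=> 0 end)).
by move=> -[|[|k]] x; [exact: is_derive_id|exact: is_derive_cst|exact: is_derive_cst].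
Qed.

Lemma is_derive_quadratic f (x d C r : R) : 0 < r ->
  (forall h, `|h| < r -> `|f (h + x) - f x - h * d| <= C * h ^+ 2) -> is_derive x 1 f d.
Proof.
move=> r0 H.
have lim : h^-1 *: (f (h *: 1 + x) - f x) @[h --> 0^'] --> d.
  apply/cvgrPdist_le => e e0; near=> h.
  have h0 : h != 0 by near: h; exact: nbhs_dnbhs_neq.
  have hr : `|h| < r by near: h; exact: dnbhs0_lt.
  have C1 : 0 < `|C| + 1 by rewrite ltr_wpDl.
  have hC : `|h| <= e / (`|C| + 1) by near: h; apply: dnbhs0_le; rewrite divr_gt0.
  rewrite [h *: 1]mulr1 [_ *: _](_ : _ = h^-1 * (f (h + x) - f x))//.
  rewrite distrC [X in `|X|](_ : _ = h^-1 * (f (h + x) - f x - h * d)); last by field.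
  rewrite normrM normfV ler_pdivrMl ?normr_gt0//.
  apply: le_trans (H h hr) _; rewrite -(real_normK (num_real h)) expr2 mulrCA ler_wpM2l//.
  move: hC; rewrite ler_pdivlMr// mulrC; apply: le_trans.
  by rewrite ler_wpM2r// (le_trans (ler_norm _))// lerDl.
by split; [apply/cvgP; exact: lim|exact: cvg_lim lim].
Unshelve. all: by end_near.
Qed.

Definition flat (x : R) : R := if 0 < x then expR (- x^-1) else 0.

(** For x > 0 the derivative of q(1/x) e^(-1/x) is x^-2 (q - q')(1/x) e^(-1/x). *)
Let flat_poly k : {poly R} := iter k (fun q => 'X^2 * (q - q^`())) 1.

Let flat_tower k (x : R) : R := if 0 < x then (flat_poly k).[x^-1] * expR (- x^-1) else 0.

(** At y = 1/h the bound reads C h^2, the quadratic estimate that gives derivative 0 at the origin.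
    It comes from e^y >= y^(i+2) / (i+2)!. *)
Let poly_expR_bound (q : {poly R}) : exists2 C, 0 <= C &
  forall y, 0 < y -> `|q.[y] * expR (- y)| <= C / y ^+ 2.
Proof.
exists (\sum_(i < size q) `|q`_i| * (i.+2)`!%:R) => [|y y0].
  by rewrite sumr_ge0// => i _; rewrite mulr_ge0.
rewrite horner_coef mulr_suml; apply: le_trans (ler_norm_sum _ _ _) _.
rewrite mulr_suml; apply: ler_sum => i _.
rewrite !normrM -!mulrA ler_wpM2l// normrX !gtr0_norm ?expR_gt0//.
rewrite expRN ler_pdivrMr ?expR_gt0// mulrAC ler_pdivlMr ?exprn_gt0// -exprD addn2.
rewrite -ler_pdivrMl ?ltr0n ?fact_gt0// mulrC.
have := @expR_ge1Dxn R y i.+1 (ltW y0); apply: le_trans.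
by rewrite lerDr.
Qed.

Lemma smooth_flat : smooth_fun flat.
Proof.
have -> : flat = flat_tower 0.
  by apply/funext => x; rewrite /flat /flat_tower /= hornerC mul1r.
apply: smooth_tower => k x.
have [x0|x0|->] := ltrgt0P x.
- have dV : is_derive x 1 (fun y : R => y^-1) (- x ^- 2).
    have := @is_deriveV R id x 1 1 (lt0r_neq0 x0) (is_derive_id _ _).
    by rewrite /GRing.scale /= mulr1.
  have de : is_derive x 1 (fun y : R => expR (- y^-1)) (expR (- x^-1) * x ^- 2).
    have dN : is_derive x 1 (fun y : R => - y^-1) (x ^- 2).
      by rewrite -[x ^- 2]opprK; exact: is_deriveN.
    exact: (is_derive1_comp (is_derive_expR _) dN).
  have dq : is_derive x 1 (fun y : R => (flat_poly k).[y^-1])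
      ((flat_poly k)^`().[x^-1] * - x ^- 2).
    exact: (is_derive1_comp (is_derive_poly _ _) dV).
  apply: near_eq_is_derive; last first.
    apply: (is_derive_eq (is_deriveM dq de)).
    rewrite /flat_tower x0 /flat_poly iterS -/(flat_poly k) hornerM hornerXn hornerD hornerN.
    rewrite /GRing.scale /= exprVn; ring.
  near=> y; rewrite /flat_tower ifT//; near: y; exact: lt_nbhsr.
- have -> : flat_tower k.+1 x = 0 by rewrite /flat_tower ltNge (ltW x0).
  apply: near_eq_is_derive (is_derive_cst (0 : R) x 1).
  near=> y; rewrite /flat_tower ltNge ltW//=.
  near: y; exact: lt_nbhsl.
have [C C0 HC] := poly_expR_bound (flat_poly k).
apply: (@is_derive_quadratic _ _ _ C 1) => // h _.
rewrite /flat_tower ltxx mulr0 !subr0 addr0; case: ifPn => [h0|_]; last first.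
  by rewrite normr0 mulr_ge0// sqr_ge0.
have := HC h^-1; rewrite invr_gt0 => /(_ h0)/le_trans; apply.
by rewrite exprVn invrK.
Unshelve. all: by end_near.
Qed.

End SmoothFunctions.

(** * Bump functions and fast converging series *)

Section Bump.
Context {R : realType}.

Lemma flat_ge0 (x : R) : 0 <= flat x.
Proof. by rewrite /flat; case: ifP => // _; exact: expR_ge0. Qed.

Lemma flat_le0 (x : R) : x <= 0 -> flat x = 0.
Proof. by rewrite /flat leNgt => /negbTE ->. Qed.

Lemma flat_le (x y : R) : x <= y -> flat x <= flat y.
Proof.
move=> xy; have [x0|x0] := leP x 0; first by rewrite (flat_le0 x0) flat_ge0.
have y0 := lt_le_trans x0 xy.
by rewrite /flat x0 y0 ler_expR lerN2 lef_pV2.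
Qed.

Lemma flat_gt0 (x : R) : 0 < x -> 0 < flat x.
Proof. by move=> x0; rewrite /flat x0 expR_gt0. Qed.

Let c : R := flat (16^-1 - 64^-1).

(** Nesting [flat] avoids dividing functions. The inner term vanishes for |x| <= 1/8 and is at least
    [c], its value at |x| = 1/4, for |x| >= 1/4. *)
Definition plateau (x : R) : R := (flat c)^-1 * flat (c - flat (x * x - 64^-1)).

Let c0 : 0 < flat c.
Proof. by do 2 apply: flat_gt0; lra. Qed.

Lemma smooth_plateau : smooth_fun plateau.
Proof.
apply: smooth_funM; first exact: smooth_fun_cst.
apply: (smooth_fun_comp smooth_flat).
apply: smooth_funD; first exact: smooth_fun_cst.
rewrite (_ : (fun x => - _) = fun x => -1 * flat (x * x - 64^-1)); last first.
  by apply/funext => x; rewrite mulN1r.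
apply: smooth_funM; first exact: smooth_fun_cst.
apply: (smooth_fun_comp smooth_flat).
apply: smooth_funD; last exact: smooth_fun_cst.
by apply: smooth_funM; exact: smooth_fun_id.
Qed.

Lemma plateau_eq1 (x : R) : `|x| <= 8^-1 -> plateau x = 1.
Proof.
move=> x8; rewrite /plateau (@flat_le0 (x * x - _)) ?subr0 ?mulVf ?gt_eqF//.
rewrite -expr2 -(real_normK (num_real x)) expr2; have := normr_ge0 x; nra.
Qed.

Lemma plateau_eq0 (x : R) : 4^-1 <= `|x| -> plateau x = 0.
Proof.
move=> x4; rewrite /plateau (@flat_le0 (c - _)) ?mulr0// subr_le0; apply: flat_le.
rewrite -expr2 -(real_normK (num_real x)) expr2; nra.
Qed.

Lemma plateau_norm (x : R) : `|plateau x| <= 1.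
Proof.
rewrite ger0_norm ?mulr_ge0 ?flat_ge0 ?invr_ge0 ?(ltW c0)//.
by rewrite ler_pdivrMl// mulr1 flat_le// gerBl flat_ge0.
Qed.

Lemma derive1n_eq0 (chi : R -> R) (k : nat) (x : R) :
  (forall y, 4^-1 <= `|y| -> chi y = 0) -> 4^-1 < `|x| -> derive1n k chi x = 0.
Proof.
move=> chi0 x4; pose A := [set y : R | 4^-1 < `|y|].
have oA : open A.
  have /continuousP/(_ _ (@open_gt R 4^-1)) := @norm_continuous R R; exact.
have [_ ->//] := @tower_derive1n R A (fun _ _ => 0) chi oA
  (fun y Ay => esym (chi0 y (ltW Ay))) (fun _ y _ => is_derive_cst (0 : R) y 1) k x x4.
Qed.

Lemma derive1n_bounded (chi : R -> R) k : smooth_fun chi ->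
  (forall y, 4^-1 <= `|y| -> chi y = 0) ->
  exists M, forall x, `|derive1n k chi x| <= M.
Proof.
move=> schi chi0.
have cchi : {within `[-1, 1], continuous (fun x => `|derive1n k chi x|)}.
  apply: continuous_subspaceT => x; apply: (@continuous_comp _ _ _ (derive1n k chi) Num.norm).
    by apply: differentiable_continuous; apply/derivable1_diffP; exact: schi.
  exact: norm_continuous.
have [|z _ Hz] := @EVT_max R (fun x => `|derive1n k chi x|) (-1) 1 _ cchi; first lra.
exists `|derive1n k chi z| => x; have [x1|x1] := leP `|x| 1.
  by apply: Hz; rewrite in_itv /= -ler_norml.
by rewrite (derive1n_eq0 k chi0) ?normr0//; lra.
Qed.

End Bump.

Section BumpSeries.
Context {R : realType}.

(** The square outweighs the factor 2^(n k) created by differentiating k times a bump of width about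
    2^-n. *)
Definition fast (n : nat) : R := 2^-1 ^+ (n * n).

Lemma fast_gt0 n : 0 < fast n.
Proof. by rewrite exprn_gt0. Qed.

Lemma fast_le1 n : fast n <= 1.
Proof. by rewrite exprn_ile1//; lra. Qed.

Lemma fast_geometric k n : fast n * (2 ^+ n) ^+ k <= 2 ^+ (k.+1 * k.+1) * 2^-1 ^+ n.
Proof.
rewrite /fast !exprVn -exprM mulrC ler_pdivrMr ?exprn_gt0//.
rewrite mulrAC ler_pdivlMr ?exprn_gt0// -!exprD ler_weXn2l//; first lra.
nia.
Qed.

Lemma cvg_half : (fun n => 2^-1 ^+ n : R) @ \oo --> (0 : R).
Proof.
have := @cvg_geometric R 1 2^-1; rewrite /geometric /=.
under eq_cvg do rewrite mul1r.
by apply; rewrite ger0_norm; lra.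
Qed.

Variables (chi : R -> R) (A : R^nat) (C : R).
Hypotheses (schi : smooth_fun chi) (chi0 : forall y, 4^-1 <= `|y| -> chi y = 0).
Hypothesis AC : forall n, `|A n| <= C * fast n.

Let term k x n := A n * (2 ^+ n) ^+ k * derive1n k chi (2 ^+ n * x - 1).

Let C0 : 0 <= C.
Proof. by have := le_trans (normr_ge0 _) (AC 0); rewrite pmulr_lge0 ?fast_gt0. Qed.

Let coef_bound k M : 0 <= M -> forall n,
  `|A n| * (2 ^+ n) ^+ k * M <= C * 2 ^+ (k.+1 * k.+1) * M * 2^-1 ^+ n.
Proof.
move=> M0 n; rewrite [leRHS]mulrAC ler_wpM2r// -mulrA.
apply: le_trans (_ : C * fast n * (2 ^+ n) ^+ k <= _).
  by rewrite ler_wpM2r ?exprn_ge0.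
by rewrite -mulrA ler_wpM2l// fast_geometric.
Qed.

Let cvg_term k x : cvgn (series (term k x)).
Proof.
have [M chiM] := derive1n_bounded k schi chi0.
have M0 : 0 <= M by exact: le_trans (chiM 0).
have [] := @series_geometric_bound R (term k x) (C * 2 ^+ (k.+1 * k.+1) * M).
  move=> n; apply: le_trans (coef_bound k M0 n).
  by rewrite /term !normrM (@ger0_norm _ ((2 ^+ n) ^+ k)) ?exprn_ge0// ler_wpM2l// mulr_ge0 ?exprn_ge0.
by [].
Qed.

(** Termwise differentiation: the first-order Taylor remainder of each term is bounded through its
    derivative of order k + 2, and these bounds sum to a multiple of h^2. *)
Lemma smooth_bump_series :
  smooth_fun (fun x => limn (series (fun n => A n * chi (2 ^+ n * x - 1)))).
Proof.
rewrite (_ : (fun x => _) = fun x => limn (series (term 0 x))); last first.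
  by apply/funext => x; congr (limn (series _)); apply/funext => n; rewrite /term expr0 mulr1.
apply: (@smooth_tower _ (fun k x => limn (series (term k x)))) => k x.
have [M chiM] := derive1n_bounded k.+2 schi chi0.
have M0 : 0 <= M by exact: le_trans (chiM 0).
apply: (@is_derive_quadratic _ _ _ _ (2 * (C * 2 ^+ (k.+3 * k.+3) * M)) 1) => // h _.
have -> : limn (series (term k (h + x))) - limn (series (term k x)) - h * limn (series (term k.+1 x)) =
   limn (series (fun n => term k (h + x) n - term k x n - h * term k.+1 x n)).
  apply/esym/cvg_lim => //.
  rewrite (_ : series _ = fun N => series (term k (h + x)) N - series (term k x) N
     - h * series (term k.+1 x) N); last first.
    by apply/funext => N; rewrite /series /= mulr_sumr -!sumrB.
  by apply: cvgB; [apply: cvgB; exact: cvg_term|apply: cvgMl_tmp; exact: cvg_term].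
have [|_] := @series_geometric_bound R (fun n => term k (h + x) n - term k x n - h * term k.+1 x n)
   (C * 2 ^+ (k.+3 * k.+3) * M * h ^+ 2); last by rewrite !mulrA.
move=> n.
rewrite [leRHS](_ : _ = C * 2 ^+ (k.+3 * k.+3) * M * 2^-1 ^+ n * h ^+ 2); last by ring.
apply: le_trans (ler_wpM2r (sqr_ge0 h) (coef_bound k.+2 M0 n)).
set y := 2 ^+ n * x - 1; have hy : 2 ^+ n * (h + x) - 1 = 2 ^+ n * h + y.
  by rewrite mulrDr addrA.
have := @taylor_bound R (fun j => derive1n (k + j) chi) (`|2 ^+ n * h| + 1) y 1 (2 ^+ n * h + y) M.
rewrite addrK ltrDl ltr01 => /(_ isT) taylor.
have {taylor} : `|derive1n k chi (2 ^+ n * h + y) - (derive1n k chi y +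
   derive1n k.+1 chi y * (2 ^+ n * h))| <= M * `|2 ^+ n * h| ^+ 2.
  move: taylor; rewrite !big_ord_recr big_ord0 /= addn0 add0r expr0 expr1 !mulr1.
  rewrite addn1 addn2 !divr1; apply => // j z _.
  by rewrite addnS; apply: is_derive1n; exact: schi.
rewrite /term hy -/y => H.
rewrite (_ : _ - _ - _ = A n * (2 ^+ n) ^+ k * (derive1n k chi (2 ^+ n * h + y) -
  (derive1n k chi y + derive1n k.+1 chi y * (2 ^+ n * h)))); last first.
  by rewrite (exprSr _ k); ring.
rewrite normrM normrM (@ger0_norm _ ((2 ^+ n) ^+ k)) ?exprn_ge0//.
rewrite [leRHS](_ : _ = `|A n| * (2 ^+ n) ^+ k * (M * `|2 ^+ n * h| ^+ 2)).
  by rewrite ler_wpM2l// mulr_ge0 ?exprn_ge0.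
rewrite real_normK ?num_real//; move: (2 ^+ n) => p.
by rewrite exprMn -[k.+2]addn2 exprD; ring.
Qed.

End BumpSeries.

(* [special_curve z u] runs through [z n] with velocity [2 ^ n u n] at time
   [2 ^ - n]; it vanishes between the disjoint supports of the bumps. *)
Section SpecialCurve.
Context {R : realType} {X : normedModType R}.
Variables (z u : nat -> X).

Definition special_curve (t : R) : X :=
  if pselect (exists n : nat, `|2 ^+ n * t - 1| < 4^-1) is left tn then
    let n := projT1 (cid tn) in
    plateau (2 ^+ n * t - 1) *: (z n + (2 ^+ n * t - 1) *: u n)
  else 0.

(** The supports are the intervals 2^-n (3/4, 5/4), disjoint because 2 * 3/4 > 5/4. *)
Let support_unique (m n : nat) (t : R) :
  `|2 ^+ m * t - 1| < 4^-1 -> `|2 ^+ n * t - 1| < 4^-1 -> m = n.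
Proof.
wlog: m n / (m <= n)%N => [hw|].
  by have [/hw//|/ltnW/hw H ? ?] := leqP m n; apply/esym/H.
rewrite leq_eqVlt => /orP[/eqP//|mn]; rewrite !ltr_norml => /andP[m1 m2] /andP[n1 n2].
have t0 : 0 < 2 ^+ m * t by lra.
move: n1 n2; rewrite -(subnK mn) exprD exprS -!mulrA => n1 n2.
have : 1 * (2 * (2 ^+ m * t)) <= 2 ^+ (n - m.+1) * (2 * (2 ^+ m * t)).
  by apply: ler_wpM2r; [lra|rewrite exprn_ege1//; lra].
by move=> H; exfalso; lra.
Qed.

Lemma special_curveE n t : `|2 ^+ n * t - 1| < 4^-1 ->
  special_curve t = plateau (2 ^+ n * t - 1) *: (z n + (2 ^+ n * t - 1) *: u n).
Proof.
move=> tn; rewrite /special_curve; case: pselect => [p|[]]; last by exists n.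
by rewrite (support_unique (projT2 (cid p)) tn).
Qed.

Lemma special_curve_plateau n (s : R) : `|s| <= 8^-1 ->
  special_curve (2^-1 ^+ n * (1 + s)) = z n + s *: u n.
Proof.
move=> s8; have E : 2 ^+ n * (2^-1 ^+ n * (1 + s)) - 1 = s.
  by rewrite exprVn mulVKf ?expf_neq0 ?pnatr_eq0// addrAC subrr add0r.
by rewrite (@special_curveE n) E ?plateau_eq1 ?scale1r//; lra.
Qed.

Lemma special_curve0 : special_curve 0 = 0.
Proof.
rewrite /special_curve; case: pselect => // p.
by exfalso; have [n] := p; rewrite mulr0 sub0r normrN normr1; lra.
Qed.

Lemma special_curve_norm (r : R) : 0 < r -> (forall n, `|z n| + `|u n| < r) ->
  forall t, `|special_curve t| < r.
Proof.
move=> r0 zur t; rewrite /special_curve; case: pselect => [p|_]; last by rewrite normr0.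
move: (projT2 (cid p)); set n := projT1 _ => tn /=; apply: le_lt_trans (zur n).
rewrite normrZ; apply: le_trans (_ : 1 * `|z n + (2 ^+ n * t - 1) *: u n| <= _).
  by rewrite ler_wpM2r// plateau_norm.
rewrite mul1r (le_trans (ler_normD _ _))// lerD2l normrZ ler_piMl//.
by lra.
Qed.

Lemma smooth_special_curve (l : X -> R) (C : R) : scalar l ->
  (forall x, `|l x| <= C * `|x|) ->
  (forall n, `|z n| <= fast n) -> (forall n, `|u n| <= fast n) ->
  smooth_fun (l \o special_curve).
Proof.
move=> lin lC zf uf.
have C0n n : C * `|z n| <= `|C| * fast n.
  by apply: le_trans (ler_wpM2l (normr_ge0 C) (zf n)); rewrite ler_wpM2r// ler_norm.
have C0u n : C * `|u n| <= `|C| * fast n.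
  by apply: le_trans (ler_wpM2l (normr_ge0 C) (uf n)); rewrite ler_wpM2r// ler_norm.
have l0 : l 0 = 0.
  by have := lin (-1) 0 0; rewrite scaler0 addr0 mulN1r addrC subrr.
have lD a b : l (a + b) = l a + l b by have := lin 1 a b; rewrite scale1r mul1r.
have lZ a b : l (a *: b) = a * l b by have := lin a b 0; rewrite !addr0 l0 addr0.
pose chi1 (x : R) := x * plateau x.
have schi1 : smooth_fun chi1 by apply: smooth_funM; [exact: smooth_fun_id|exact: smooth_plateau].
have chi10 (y : R) : 4^-1 <= `|y| -> chi1 y = 0 by move=> /plateau_eq0; rewrite /chi1 => ->; rewrite mulr0.
(* Position and velocity give two bump series, with profiles plateau(x) and x plateau(x); at each
   time at most one index contributes. *)
rewrite (_ : l \o special_curve = fun t =>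
  limn (series (fun n => l (z n) * plateau (2 ^+ n * t - 1))) +
  limn (series (fun n => l (u n) * chi1 (2 ^+ n * t - 1)))).
  apply: smooth_funD.
    apply: (@smooth_bump_series R plateau (fun n => l (z n)) `|C|) => //.
    - exact: smooth_plateau.
    - exact: plateau_eq0.
    - by move=> n; apply: le_trans (lC _) _.
  by apply: (@smooth_bump_series R chi1 (fun n => l (u n)) `|C|) => // n; apply: le_trans (lC _) _.
apply/funext => t /=.
have single (v : R^nat) n0 : (forall n, n != n0 -> v n = 0) -> limn (series v) = v n0.
  move=> v0; apply: lim_near_cst => //; near=> N.
  have n0N : (n0 < N)%N by near: N; exists n0.+1.
  rewrite /series /= big_mkord (bigD1 (Ordinal n0N))//= big1 ?addr0// => i.
  by rewrite -val_eqE /= => /v0.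
have far n : 4^-1 <= `|2 ^+ n * t - 1| -> plateau (2 ^+ n * t - 1) = 0 /\ chi1 (2 ^+ n * t - 1) = 0.
  by move=> tn; rewrite plateau_eq0// chi10.
have [[n0 tn0]|tn] := pselect (exists n : nat, `|2 ^+ n * t - 1| < 4^-1).
  have far0 n : n != n0 -> plateau (2 ^+ n * t - 1) = 0 /\ chi1 (2 ^+ n * t - 1) = 0.
    move=> nn0; apply: far; rewrite leNgt; apply/negP => tn.
    by move/eqP: nn0; apply; exact: support_unique tn tn0.
  rewrite (single _ n0) ?(single _ n0); last 2 first.
  - by move=> n /far0[_ ->]; rewrite mulr0.
  - by move=> n /far0[-> _]; rewrite mulr0.
  by rewrite (special_curveE tn0) lZ lD lZ /chi1; ring.
have far0 n : plateau (2 ^+ n * t - 1) = 0 /\ chi1 (2 ^+ n * t - 1) = 0.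
  by apply: far; rewrite leNgt; apply/negP => ?; apply: tn; exists n.
rewrite (single _ 0) ?(single _ 0); last 2 first.
- by move=> n _; rewrite (far0 n).2 mulr0.
- by move=> n _; rewrite (far0 n).1 mulr0.
rewrite (far0 0).1 (far0 0).2 !mulr0 addr0 /special_curve.
by case: pselect.
Unshelve. all: by end_near.
Qed.

End SpecialCurve.

(** * Power series expansion on a Banach space *)

Section BanachExpansion.
Context {R : realType} {X : completeNormedModType R}.
Variables (phi : X -> R) (r : R).
Hypothesis r0 : 0 < r.
Hypothesis smooth_phi : forall gamma : R -> X,
  (forall (l : X -> R) (C : R), scalar l -> (forall x, `|l x| <= C * `|x|) ->
    smooth_fun (l \o gamma)) ->
  (forall t, `|gamma t| < r) -> smooth_fun (phi \o gamma).
Hypothesis analytic_phi : forall v (t : R), `|t *: v| < r ->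
  analytic_at (fun s => phi (s *: v)) t.

Let smooth_continuous (g : R -> R) t : smooth_fun g -> {for t, continuous g}.
Proof.
by move=> sg; apply: differentiable_continuous; apply/derivable1_diffP; exact: (sg 0).
Qed.

Let fast_lt (d : R) : 0 < d -> exists n, fast n < d.
Proof.
move=> d0; have /cvgrPdist_lt /(_ d d0) [n _ /(_ n (leqnn n))] := @cvg_half R.
rewrite /= sub0r normrN ger0_norm ?exprn_ge0// => nd; exists n.
apply: le_lt_trans nd; rewrite ler_wiXn2l//; first lra.
by rewrite -[leqLHS]muln1; case: n => // n; rewrite leq_mul2l.
Qed.

Let smooth_phi_special (y : X) (z u : nat -> X) :
  (forall n, `|z n| <= fast n) -> (forall n, `|u n| <= fast n) ->
  (forall n, `|z n| + `|u n| < r - `|y|) ->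
  smooth_fun (fun t => phi (y + special_curve z u t)).
Proof.
move=> zf uf zur; apply: (smooth_phi (gamma := fun t => y + special_curve z u t)).
  move=> l C lin lC; rewrite (_ : _ \o _ = fun t => l y + (l \o special_curve z u) t).
    apply: smooth_funD; first exact: smooth_fun_cst.
    exact: smooth_special_curve lin lC zf uf.
  by apply/funext => t /=; have := lin 1 y (special_curve z u t); rewrite scale1r mul1r.
move=> t; apply: le_lt_trans (ler_normD _ _) _; rewrite -ltrBrDl.
apply: special_curve_norm => //; apply: le_lt_trans (zur 0).
by rewrite addr_ge0.
Qed.

Let phi_continuous y : `|y| < r -> {for y, continuous phi}.
Proof.
move=> yr; apply/cvgrPdist_lt => e e0; apply: contrapT => not_near.
have bad n : exists z, [/\ `|z| <= fast n, `|z| < r - `|y| & e <= `|phi y - phi (y + z)|].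
  apply: contrapT => no_z; apply: not_near.
  have d0 : 0 < Num.min (fast n) (r - `|y|) by rewrite lt_min fast_gt0 subr_gt0.
  apply/nbhs_ballP; exists (Num.min (fast n) (r - `|y|)) => // x.
  rewrite -ball_normE /= lt_min => /andP[xf xr]; rewrite ltNge; apply/negP => ephi.
  apply: no_z; exists (x - y); rewrite (distrC x y); split => //; first exact: ltW.
  by rewrite [y + _]addrC subrK.
have [z Hz] := choice bad.
pose u (n : nat) : X := 0.
have sphi : smooth_fun (fun t => phi (y + special_curve z u t)).
  apply: smooth_phi_special => n; rewrite ?normr0 ?addr0; last by have [] := Hz n.
    by have [] := Hz n.
  exact: ltW (fast_gt0 n).
have := @smooth_continuous _ 0 sphi; rewrite /prop_for /continuous_at special_curve0 addr0 => cphi.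
have := cvg_comp _ _ (@cvg_half R) cphi => /cvgrPdist_lt /(_ e e0) [N _ /(_ N (leqnn N))] /=.
have := @special_curve_plateau R X z u N 0; rewrite normr0 addr0 mulr1 scale0r addr0.
move=> -> //; have [_ _ ez] := Hz N; by rewrite ltNge ez.
Qed.

Let p m v : R := derive1n m (fun s : R => phi (s *: v)) 0 / m`!%:R.

Let analytic0 v : analytic_at (fun s => phi (s *: v)) 0.
Proof. by apply: analytic_phi; rewrite scale0r normr0. Qed.

Let phi_taylor v m : exists B d, 0 < d /\ forall s, `|s| < d ->
  `|phi (s *: v) - \sum_(k < m.+1) p k v * s ^+ k| <= B * `|s| ^+ m.+1.
Proof.
have [B [d [d0 H]]] := analytic_at_taylor_bound m (analytic0 v).
by exists B, d; split => // s sd; have := H s; rewrite !subr0; apply.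
Qed.

Let phi_taylor_unif (v : nat -> X) m n : exists B d, [/\ 0 <= B, 0 < d & forall i s,
  (i <= n)%N -> `|s| < d ->
  `|phi (s *: v i) - \sum_(k < m.+1) p k (v i) * s ^+ k| <= B * `|s| ^+ m.+1].
Proof.
elim: n => [|n [B [d [B0 d0 H]]]].
  have [B [d [d0 H]]] := phi_taylor (v 0%N) m.
  exists `|B|, d; split => // i s; rewrite leqn0 => /eqP -> sd.
  by apply: le_trans (H s sd) _; rewrite ler_wpM2r ?exprn_ge0// ler_norm.
have [B' [d' [d'0 H']]] := phi_taylor (v n.+1) m.
exists (B + `|B'|), (Num.min d d'); split; rewrite ?addr_ge0 ?lt_min ?d0// => i s.
rewrite lt_min leq_eqVlt => /orP[/eqP -> /andP[_ sd]|ni /andP[sd _]].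
  apply: le_trans (H' s sd) _; rewrite ler_wpM2r ?exprn_ge0//.
  by rewrite (le_trans (ler_norm _))// lerDr.
by apply: le_trans (H i s ni sd) _; rewrite ler_wpM2r ?exprn_ge0// lerDl.
Qed.

(** Both sides are coefficients in expansions of h |-> phi(h a v) up to O(h^(m+1)), and such
    coefficients are unique. *)
Let p_homogeneous a m v : p m (a *: v) = a ^+ m * p m v.
Proof.
apply/eqP; rewrite -subr_eq0; apply/eqP.
apply: (@poly_small_eq0 R (fun k => p k (a *: v) - a ^+ k * p k v) m _ m (leqnn m)) => e e0.
have [B [d [d0 H]]] := phi_taylor (a *: v) m.
have [B' [d' [d'0 H']]] := phi_taylor v m.
pose K := `|B| + `|B'| * `|a| ^+ m.+1 + 1.
have K0 : 0 < K by rewrite ltr_pwDr// addr_ge0// mulr_ge0// exprn_ge0.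
pose h := Num.min (Num.min (e / 2) (d / 2)) (Num.min (e / K) (d' / (2 * (`|a| + 1)))).
have a1 : 0 < `|a| + 1 by rewrite ltr_wpDl.
have h0 : 0 < h by rewrite !lt_min !divr_gt0 ?mulr_gt0.
have : h <= h by []; rewrite {2}/h !le_min => /andP[/andP[he hd] /andP[hK hd']].
have hn : `|h| = h by rewrite gtr0_norm.
exists h; split => //; first lra.
have hah : `|h * a| < d'.
  rewrite normrM hn; apply: le_lt_trans (_ : h * (`|a| + 1) < _).
    by rewrite ler_wpM2l ?(ltW h0)// lerDl.
  rewrite -ltr_pdivlMr//; apply: le_lt_trans hd' _.
  by rewrite ltr_pM2l// ltf_pV2 ?posrE ?mulr_gt0//; lra.
have hd2 : h < d by lra.
have H1 := H h; rewrite hn in H1; have {}H1 := H1 hd2.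
have H2 := H' (h * a) hah; rewrite normrM hn exprMn -scalerA in H2.
rewrite (_ : \sum_(j < m.+1) _ =
  (phi (h *: (a *: v)) - \sum_(k < m.+1) p k v * (h * a) ^+ k) -
  (phi (h *: (a *: v)) - \sum_(k < m.+1) p k (a *: v) * h ^+ k)); last first.
  rewrite opprB [RHS]addrC addrA subrK -sumrB; apply: eq_bigr => i _.
  by rewrite exprMn; ring.
apply: le_trans (ler_normB _ _) _.
apply: le_trans (lerD H2 H1) _.
apply: le_trans (_ : (h * K) * h ^+ m <= _); last first.
  by rewrite ler_wpM2r ?exprn_ge0 ?(ltW h0)// -ler_pdivlMr.
rewrite exprS; have hm0 : 0 <= h * h ^+ m by rewrite mulr_ge0 ?exprn_ge0 ?(ltW h0).
have BB : B <= `|B| by exact: ler_norm.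
have BB' : B' * `|a| ^+ m.+1 <= `|B'| * `|a| ^+ m.+1 by rewrite ler_wpM2r ?exprn_ge0 ?ler_norm.
rewrite [leLHS](_ : _ = (h * h ^+ m) * (B' * `|a| ^+ m.+1 + B)); last by ring.
by rewrite [leRHS]mulrAC ler_wpM2l// /K; lra.
Qed.

(* The curve through [h v] with velocity [fast n * u], where
   [h = fast n ^+ m.+2], meets the points [h (v + i u)] in so short a time
   that the smoothness of [phi] along it makes the difference [o(h ^ m)]. *)
Let p_frechet_small m j u v : (j <= m)%N -> `|u| <= 1 -> `|v| <= 1 ->
  `|u| <= r / 4 -> `|v| <= r / 4 -> fdiff (nseq m.+1 u) (p j) v = 0.
Proof.
move=> jm u1 v1 ur vr.
pose z n : X := fast n ^+ m.+2 *: v; pose w n : X := fast n *: u.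
have fpow n k : fast n ^+ k.+1 <= fast n :> R.
  by rewrite exprS ler_piMr ?(ltW (fast_gt0 n))// exprn_ile1 ?fast_le1 ?(ltW (fast_gt0 n)).
have zf n (b : R) : `|v| <= b -> `|z n| <= fast n * b.
  move=> vb; rewrite normrZ ger0_norm ?exprn_ge0 ?(ltW (fast_gt0 n))//.
  by rewrite ler_pM ?exprn_ge0 ?(ltW (fast_gt0 n))// fpow.
have wf n (b : R) : `|u| <= b -> `|w n| <= fast n * b.
  by move=> ub; rewrite normrZ gtr0_norm ?fast_gt0// ler_wpM2l ?(ltW (fast_gt0 n)).
pose g t := phi (0 + special_curve z w t).
have sg : smooth_fun g.
  apply: smooth_phi_special => n.
  - by have := zf n 1 v1; rewrite mulr1.
  - by have := wf n 1 u1; rewrite mulr1.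
  rewrite normr0 subr0; have := zf n _ vr; have := wf n _ ur.
  have : fast n * (r / 4) <= r / 4 by rewrite ler_piMl ?fast_le1 ?divr_ge0 ?(ltW r0).
  move=> H1 H2 H3; apply: le_lt_trans (lerD H3 H2) _.
  by have r1 := r0; move: H1; move: (fast n * (r / 4)) => q; lra.
(* One curve serves all n, so [M] does not depend on n. *)
have [M [M0 gM]] : exists M, 0 <= M /\ forall t, 0 <= t <= 2 -> `|derive1n m.+1 g t| <= M.
  have cg : {within `[0, 2], continuous (fun x => `|derive1n m.+1 g x|)}.
    apply: continuous_subspaceT => x; apply: (@continuous_comp _ _ _ (derive1n m.+1 g) Num.norm).
      by apply: differentiable_continuous; apply/derivable1_diffP; exact: sg.
    exact: norm_continuous.
  have [//|c _ Hc] := @EVT_max R (fun x => `|derive1n m.+1 g x|) 0 2 _ cg.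
  by exists `|derive1n m.+1 g c|; split => // t t02; apply: Hc; rewrite in_itv.
have [B [d [B0 d0 HB]]] := phi_taylor_unif (fun i => v + u *+ i) m m.+1.
have Hsum h : \sum_(k < m.+1) fdiff (nseq m.+1 u) (p k) v * h ^+ k =
    altsum m.+1 (fun i => \sum_(k < m.+1) p k (v + u *+ i) * h ^+ k).
  rewrite altsum_sum; apply: eq_bigr => k _.
  by rewrite fdiff_altsum mulrC -altsumZ; apply: eq_altsum => i _; rewrite mulrC.
apply: (@poly_small_eq0 R (fun k => fdiff (nseq m.+1 u) (p k) v) m _ j jm) => e e0.
have : exists n : nat, [/\ fast n < e, fast n < d,
    m.+1%:R * fast n <= 8^-1 :> R, M * fast n <= e / 2 & 2 ^+ m.+1 * B * fast n <= e / 2].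
  have K0 : 0 <= 2 ^+ m.+1 * B by rewrite mulr_ge0 ?exprn_ge0.
  pose D := Num.min (Num.min e d) (Num.min (8^-1 / m.+1%:R)
    (Num.min (e / 2 / (M + 1)) (e / 2 / (2 ^+ m.+1 * B + 1)))).
  have [|n] := fast_lt (d := D).
    by rewrite !lt_min e0 d0 !divr_gt0// ltr_wpDl.
  rewrite !lt_min => /andP[/andP[ne nd] /and3P[nm nM nB]]; exists n; split => //.
  - by rewrite mulrC -ler_pdivlMr ?ltr0n//; exact: ltW.
  - apply: le_trans (_ : fast n * (M + 1) <= _).
      by rewrite mulrC ler_wpM2l ?(ltW (fast_gt0 n))// lerDl.
    by rewrite -ler_pdivlMr ?ltr_wpDl//; exact: ltW.
  - apply: le_trans (_ : fast n * (2 ^+ m.+1 * B + 1) <= _).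
      by rewrite mulrC ler_wpM2l ?(ltW (fast_gt0 n))// lerDl.
    by rewrite -ler_pdivlMr ?ltr_wpDl//; exact: ltW.
move=> [n [fe fd fm feM feB]].
pose h : R := fast n ^+ m.+2; have hf : h <= fast n by exact: fpow.
have h0 : 0 < h by rewrite exprn_gt0 ?fast_gt0.
exists h; split => //; first exact: le_lt_trans hf fe.
rewrite Hsum.
have small : `|altsum m.+1 (fun i => phi (h *: (v + u *+ i)))| <= M * fast n * h ^+ m.
  (* This time step moves the curve by h u. Since (m + 1)^2 = (m + 2) m + 1, tau^(m+1) is at most
     fast n * h^m, one factor fast n better than h^m; this dictates the exponent [m.+2] in [h]. *)
  pose tau : R := 2^-1 ^+ n * fast n ^+ m.+1.
  have -> : altsum m.+1 (fun i => phi (h *: (v + u *+ i))) =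
      fdiff (nseq m.+1 tau) g (2^-1 ^+ n).
    rewrite fdiff_altsum; apply: eq_altsum => i im.
    rewrite /g add0r (_ : 2^-1 ^+ n + _ = 2^-1 ^+ n * (1 + fast n ^+ m.+1 *+ i)); last first.
      by rewrite mulrDr mulr1 /tau -mulrnAr.
    rewrite special_curve_plateau; last first.
      rewrite ger0_norm ?mulrn_wge0 ?exprn_ge0 ?(ltW (fast_gt0 n))//.
      apply: le_trans fm; rewrite -mulr_natl ler_pM ?exprn_ge0 ?(ltW (fast_gt0 n))//.
      by rewrite ler_nat.
    rewrite /z /w scalerDr -/h; congr (phi (_ + _)).
    rewrite scalerA -scalerMnr scalerMnl; congr (_ *: _).
    by rewrite mulrnAl -exprSr.
  have tau0 : 0 <= tau by rewrite mulr_ge0 ?exprn_ge0 ?(ltW (fast_gt0 n)).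
  apply: le_trans (@fdiff_norm R m.+1 (fun k => derive1n k g) (2^-1 ^+ n) 2 tau M tau0 _ _ _) _.
  - have : 2^-1 ^+ n <= 1 :> R by rewrite exprn_ile1//; lra.
    have : tau *+ m.+1 <= m.+1%:R * fast n.
      rewrite -[leLHS]mulr_natl ler_wpM2l// (le_trans _ (fpow n m))// ler_piMl ?exprn_ge0 ?(ltW (fast_gt0 n))//.
      by rewrite exprn_ile1//; lra.
    lra.
  - by move=> k x _; apply: is_derive1n; exact: sg.
  - move=> x /andP[x1 x2]; apply: gM; rewrite x2 andbT; apply: le_trans x1.
    by rewrite exprn_ge0.
  rewrite mulrC -mulrA ler_wpM2l// /tau exprMn /h.
  have : 0 <= fast n :> R by exact: ltW (fast_gt0 n).
  move: (fast n : R) => F F0; rewrite -!exprM -[leRHS]exprS.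
  have -> : ((m.+2 * m).+1 = m.+1 * m.+1)%N by rewrite !mulSn mulnS addSn.
  apply: ler_piMl; first exact: exprn_ge0.
  by apply: exprn_ile1; rewrite ?invr_ge0// invf_le1// ler1n.
rewrite (_ : altsum _ _ = altsum m.+1 (fun i => phi (h *: (v + u *+ i))) -
   altsum m.+1 (fun i => phi (h *: (v + u *+ i)) - \sum_(k < m.+1) p k (v + u *+ i) * h ^+ k)).
  apply: le_trans (ler_normB _ _) _.
  have err : `|altsum m.+1 (fun i => phi (h *: (v + u *+ i)) -
      \sum_(k < m.+1) p k (v + u *+ i) * h ^+ k)| <= 2 ^+ m.+1 * (B * h ^+ m.+1).
    apply: altsum_bound => i im; have := HB i h im; rewrite (gtr0_norm h0); apply.
    exact: le_lt_trans hf fd.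
  apply: le_trans (lerD small err) _.
  have -> : 2 ^+ m.+1 * (B * h ^+ m.+1) = (2 ^+ m.+1 * B * h) * h ^+ m by rewrite (exprS h); ring.
  rewrite -mulrDl ler_wpM2r ?exprn_ge0 ?(ltW h0)//.
  have : 2 ^+ m.+1 * B * h <= 2 ^+ m.+1 * B * fast n by rewrite ler_wpM2l// mulr_ge0 ?exprn_ge0.
  lra.
rewrite /altsum -sumrB; apply: eq_bigr => i _.
by rewrite -mulrzBl -mulrnBl opprB addrCA subrr addr0.
Qed.

Let p_frechet m s x : size s = m.+1 -> fdiff s (p m) x = 0.
Proof.
apply: fdiff_polarize => u v.
(* Homogeneity reduces arbitrary directions and base points to short ones. *)
pose c : R := Num.min 1 (r / 4) / (1 + `|u| + `|v|).
have m0 : 0 < Num.min 1 (r / 4) by rewrite lt_min ltr01 divr_gt0.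
have uv0 : 0 < 1 + `|u| + `|v| by rewrite -addrA ltr_pwDl// addr_ge0.
have c0 : 0 < c by rewrite divr_gt0.
have cw (w : X) : `|w| <= `|u| + `|v| -> `|c *: w| <= Num.min 1 (r / 4).
  move=> wuv; rewrite normrZ gtr0_norm// /c mulrAC ler_pdivrMr// ler_wpM2l ?(ltW m0)//.
  by rewrite (le_trans wuv)// -addrA lerDr.
have : `|c *: u| <= Num.min 1 (r / 4) by apply: cw; rewrite lerDl.
rewrite le_min => /andP[cu1 cur].
have : `|c *: v| <= Num.min 1 (r / 4) by apply: cw; rewrite lerDr.
rewrite le_min => /andP[cv1 cvr].
have := p_frechet_small (leqnn m) cu1 cv1 cur cvr.
rewrite !fdiff_altsum.
have -> : altsum m.+1 (fun i => p m (c *: v + c *: u *+ i)) =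
    c ^+ m * altsum m.+1 (fun i => p m (v + u *+ i)).
  rewrite -altsumZ; apply: eq_altsum => i _.
  by rewrite -p_homogeneous scalerDr scalerMnr.
by move=> /eqP; rewrite mulf_eq0 expf_eq0 gt_eqF// andbF => /eqP.
Qed.

(** Formulated with differences of [phi], whose continuity is known and makes the set closed, and
    not with the [p m]; a bound on [p m] is recovered as h tends to 0. The restriction on h keeps
    the nodes in the ball of radius [r]. *)
Let baire_set N : set X := [set v | `|v| <= r / 2 /\ forall m (h : R), 0 < h ->
  m.+1%:R * h * N.+1%:R <= 1 ->
  `|fdiff (nseq m (h *: v)) phi 0| <= h ^+ m * (N.+1%:R ^+ m.+1 * m`!%:R)].

Let baire_node (v : X) m i (h : R) N : (i <= m)%N -> 0 < h -> m.+1%:R * h * N.+1%:R <= 1 ->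
  `|v| <= r / 2 -> `|0 + (h *: v) *+ i| < r.
Proof.
move=> im h0 hN vr; rewrite add0r scalerMnl normrZ ger0_norm ?mulrn_wge0 ?(ltW h0)//.
have hi : h *+ i <= 1.
  apply: le_trans hN; apply: le_trans (_ : m.+1%:R * h <= _).
    by rewrite -[leLHS]mulr_natl ler_wpM2r ?(ltW h0)// ler_nat leqW.
  by rewrite ler_peMr ?mulr_ge0 ?(ltW h0)// ler1n.
apply: le_lt_trans (_ : `|v| < r); first by rewrite ler_piMl.
by have r1 := r0; lra.
Qed.

Let closed_baire_set N : closed (baire_set N).
Proof.
move=> v clv; have vr : `|v| <= r / 2.
  rewrite leNgt; apply/negP => rv.
  have : \forall w \near v, r / 2 < `|w|.
    by apply: cvgr_gt rv; exact: norm_continuous.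
  by move=> /clv[w [[]]]; rewrite leNgt => /negbTE/negP.
split=> // m h h0 hN; rewrite leNgt; apply/negP => big.
have cont : (fun w => `|fdiff (nseq m (h *: w)) phi 0|) w @[w --> v] -->
    `|fdiff (nseq m (h *: v)) phi 0|.
  apply: cvg_norm; rewrite fdiff_altsum; under eq_fun do rewrite fdiff_altsum.
  apply: cvg_altsum => i im.
  have cw : (0 + (h *: w) *+ i) @[w --> v] --> 0 + (h *: v) *+ i.
    apply: cvgD; first exact: cvg_cst.
    by rewrite scalerMnl; under eq_fun do rewrite scalerMnl; apply: cvgZl_tmp; exact: cvg_id.
  exact: (cvg_comp _ _ cw (phi_continuous (baire_node im h0 hN vr))).
have : \forall w \near v, h ^+ m * (N.+1%:R ^+ m.+1 * m`!%:R) <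
    `|fdiff (nseq m (h *: w)) phi 0| by exact: (cvgr_gt _ cont).
move=> /clv[w [[_ /(_ m h h0 hN)]]].
by rewrite leNgt => /negP.
Qed.

Let baire_cover (v : X) : `|v| <= r / 2 -> exists N, baire_set N v.
Proof.
move=> vr; have /analytic_atP[M [C [d [M0 C0 d0 H]]]] := analytic0 v.
(* The summands M and C make M C^m <= (N + 1)^(m+1); 2 / d confines the admissible steps to the
   interval where the derivative bounds hold. *)
pose B := M + C + 2 / d.
have B0 : 0 <= B by rewrite !addr_ge0 ?(ltW C0)// divr_ge0// ltW.
pose N := Num.truncn B.
have NB : B < N.+1%:R by rewrite truncnS_gt.
have d2 : 0 <= 2 / d by rewrite divr_ge0// ltW.
exists N; split => // m h h0 hN.
have hmd : m.+1%:R * h <= d / 2.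
  have : m.+1%:R * h * (2 / d) <= 1.
    apply: le_trans hN; rewrite ler_wpM2l ?mulr_ge0 ?(ltW h0)//.
    by apply: le_trans (ltW NB); rewrite /B lerDr addr_ge0// ltW.
  by rewrite mulrA ler_pdivrMr// mul1r -ler_pdivlMr.
have -> : fdiff (nseq m (h *: v)) phi 0 = fdiff (nseq m h) (fun s => phi (s *: v)) 0.
  rewrite !fdiff_altsum; apply: eq_altsum => i _.
  by rewrite !add0r scalerMnl.
apply: (@fdiff_norm R m (fun k => derive1n k (fun s => phi (s *: v))) 0 (d / 2) h _ (ltW h0)).
- rewrite add0r -[leLHS]mulr_natl; apply: le_trans hmd.
  by rewrite ler_wpM2r ?(ltW h0)// ler_nat.
- move=> k x /andP[x0 xd]; apply: is_derive1n; apply: (H k x _).1.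
  by rewrite subr0 ger0_norm//; lra.
- move=> x /andP[x0 xd]; have [|_ xB] := H m x.
    by rewrite subr0 ger0_norm//; lra.
  apply: le_trans xB _; rewrite ler_wpM2r// exprS.
  have MN : M <= N.+1%:R by apply: le_trans (ltW NB); rewrite /B -addrA lerDl addr_ge0// ltW.
  have CN : C <= N.+1%:R by apply: le_trans (ltW NB); rewrite /B addrAC lerDr addr_ge0.
  by rewrite ler_pM ?exprn_ge0 ?(ltW C0)// lerXn2r ?nnegrE ?(ltW C0).
Qed.

Let baire_bound N v m : baire_set N v -> `|p m v| <= N.+1%:R ^+ m.+1.
Proof.
move=> [vr HN]; have /analytic_atP[M [C [d [M0 C0 d0 H]]]] := analytic0 v.
pose g s := phi (s *: v).
have dD k x : 0 <= x <= d / 2 -> is_derive x 1 (derive1n k g) (derive1n k.+1 g x).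
  move=> /andP[x0 xd]; apply: is_derive1n; apply: (H k x _).1.
  by rewrite subr0 ger0_norm//; lra.
have small (e : R) : 0 < e -> exists tau : R, [/\ 0 < tau, tau < e &
    `|fdiff (nseq m tau) g 0| <= tau ^+ m * (N.+1%:R ^+ m.+1 * m`!%:R)].
  move=> e0; pose K : R := m.+1%:R * N.+1%:R.
  have K0 : 0 < K by rewrite mulr_gt0.
  pose tau : R := Num.min (e / 2) K^-1.
  have tau0 : 0 < tau by rewrite lt_min divr_gt0// invr_gt0.
  exists tau; split => //; first by rewrite gt_min; apply/orP; left; lra.
  have -> : fdiff (nseq m tau) g 0 = fdiff (nseq m (tau *: v)) phi 0.
    rewrite !fdiff_altsum; apply: eq_altsum => i _.
    by rewrite /g !add0r scalerMnl.
  apply: HN => //; rewrite mulrAC -/K -ler_pdivlMl// mulr1.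
  by rewrite ge_min lexx orbT.
have d2 : 0 < d / 2 by rewrite divr_gt0.
rewrite /p normf_div [X in _ / X]ger0_norm// ler_pdivrMr ?ltr0n ?fact_gt0//.
rewrite ler_norml; apply/andP; split; last first.
  apply: (@tower_le_fdiff R (fun k => derive1n k g) m 0 (d / 2)) => // e /small[tau [t0 te ht]].
  by exists tau; split => //; apply: le_trans ht; exact: ler_norm.
rewrite lerNl; apply: (@tower_le_fdiff R (fun k x => - derive1n k g x) m 0 (d / 2)) => //.
  by move=> k x xd; apply: is_deriveN; exact: dD.
move=> e /small[tau [t0 te ht]]; exists tau; split => //.
by apply: le_trans ht; rewrite fdiffN -normrN; exact: ler_norm.
Qed.

Let p_bounded_ball : exists (v0 : X) (e N : R), [/\ 0 < e, 1 <= N &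
  forall m (v : X), `|v - v0| < e -> `|p m v| <= N ^+ m.+1].
Proof.
have [N HN] : exists N, ~ dense (~` baire_set N).
  apply: contrapT => all_dense.
  have : dense (\bigcap_N (~` baire_set N)).
    apply: Baire => N; split; first by rewrite openC; exact: closed_baire_set.
    by apply: contrapT => nd; apply: all_dense; exists N.
  have o0 : (ball (0 : X) (r / 2)) !=set0.
    by exists 0; apply: ballxx; rewrite divr_gt0.
  have ob : open (ball (0 : X) (r / 2)) by apply: ball_open; rewrite divr_gt0.
  move=> /(_ _ o0 ob)[v [vr Hv]].
  have [|N] := @baire_cover v.
    by move: vr; rewrite -ball_normE /= sub0r normrN => /ltW.
  exact: Hv.
have [V [[v0 Vv0] oV VN]] : exists V : set X, [/\ V !=set0, open V & V `<=` baire_set N].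
  apply: contrapT => noV; apply: HN => V V0 oV; apply: contrapT => VN.
  apply: noV; exists V; split => // v Vv; apply: contrapT => vN.
  by apply: VN; exists v.
have /nbhs_ballP[e /= e0 He] := open_nbhs_nbhs (conj oV Vv0).
exists v0, e, N.+1%:R; split; rewrite ?ler1n// => m v ve.
apply: baire_bound; apply: VN; apply: He.
by rewrite -ball_normE /= distrC.
Qed.

Let fdiff_ball_bound (g : X -> R) (s : seq X) (x : X) (B : R) :
  (forall y : X, `|y - x| <= \sum_(w <- s) `|w| -> `|g y| <= B) ->
  `|fdiff s g x| <= 2 ^+ size s * B.
Proof.
elim: s x => [|w s IH] x gB /=.
  by rewrite mul1r gB// subrr normr0 big_nil.
apply: le_trans (ler_normB _ _) _.
rewrite exprS -mulrA mulr_natl mulr2n lerD// IH// => y yx; apply: gB; rewrite big_cons.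
  apply: le_trans (_ : `|w + (y - (x + w))| <= _).
    by rewrite opprD addrCA [w + _]addrC subrK.
  by rewrite (le_trans (ler_normD _ _))// lerD2l.
by rewrite (le_trans yx)// lerDr.
Qed.

(** The polar form of [p m]. Its base point 0 is immaterial, because differences of order m + 1
    vanish. *)
Definition expansion_form m (s : seq X) : R := fdiff s (p m) 0 / m`!%:R.

Let form_additive m s1 s2 u v : (size s1 + size s2).+1 = m ->
  expansion_form m (s1 ++ (u + v) :: s2) =
  expansion_form m (s1 ++ u :: s2) + expansion_form m (s1 ++ v :: s2).
Proof.
move=> sm; rewrite /expansion_form -mulrDl; congr (_ / _).
exact: (fdiff_additive (p_frechet (m := m))).
Qed.

Let form_diag m y : expansion_form m (nseq m y) = p m y.
Proof.
rewrite /expansion_form fdiff_altsum.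
have -> : altsum m (fun i => p m (0 + y *+ i)) = p m y * altsum m (fun i => ('X^m).[i%:R]).
  rewrite -altsumZ; apply: eq_altsum => i _.
  by rewrite add0r -scaler_nat p_homogeneous hornerXn mulrC.
rewrite altsum_horner ?size_polyXn// coefXn eqxx -[1 *+ m`!]/(m`!%:R).
by rewrite mulfK// pnatr_eq0 -lt0n fact_gt0.
Qed.

Let form_scale m (s : seq X) (a : R) : size s = m -> fdiff (map ( *:%R a) s) (p m) 0 = a ^+ m * fdiff s (p m) 0.
Proof.
move=> sm; have aD : {morph ( *:%R a) : x y / x + y :> X} by move=> x y; rewrite scalerDr.
have := @fdiff_shift X X R ( *:%R a) 0 s (p m) 0 aD.
rewrite scaler0 addr0 => <-.
rewrite (@fdiff_comp _ _ _ ( *%R (a ^+ m)) s); last by move=> x y; rewrite mulrBr.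
by congr (fdiff _ _ _); apply/funext => x /=; rewrite add0r p_homogeneous.
Qed.

(** The difference at 0 equals the one at [v0], the centre of the ball on which Baire's theorem
    bounds all [p m]. *)
Let form_bound1 : exists2 K : R, 0 <= K & forall m (s : seq X), size s = m ->
  all (fun w : X => `|w| <= 1) s -> `|expansion_form m s| <= K ^+ m.+1.
Proof.
have [v0 [e [N [e0 N1 HN]]]] := p_bounded_ball.
have N0 : 0 <= N by exact: le_trans N1.
exists (N * (4 * (1 + 4 / e))) => [|m s sm s1].
  by rewrite !mulr_ge0// addr_ge0// divr_ge0// ltW.
(* Shrinking m unit directions by [a] keeps their sums shorter than [e]. Undoing it costs a^-m, of
   the order of m^m, which the division by m! absorbs. *)
pose a : R := e / (2 * m.+1%:R).
have a0 : 0 < a by rewrite divr_gt0// mulr_gt0.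
have := form_scale a sm.
rewrite -(fdiff_base (p_frechet (m := m)) v0); last by rewrite size_map.
move=> Es; have E : fdiff s (p m) 0 = (a ^+ m)^-1 * fdiff (map ( *:%R a) s) (p m) v0.
  by rewrite Es mulKf// expf_neq0// lt0r_neq0.
have fB : `|fdiff (map ( *:%R a) s) (p m) v0| <= 2 ^+ m * N ^+ m.+1.
  have := @fdiff_ball_bound (p m) (map ( *:%R a) s) v0 (N ^+ m.+1).
  rewrite size_map sm; apply => y yv; apply: HN; apply: le_lt_trans yv _.
  rewrite big_map; apply: le_lt_trans (_ : \sum_(w <- s) a < _).
    rewrite big_seq [leRHS]big_seq; apply: ler_sum => w ws.
    by rewrite normrZ gtr0_norm// ler_piMr ?(ltW a0)// (allP s1).
  rewrite big_const_seq count_predT sm iter_addr_0 -[ltLHS]mulr_natr /a mulrAC.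
  rewrite ltr_pdivrMr ?mulr_gt0// ltr_pM2l// -natrM ltr_nat mul2n -addnn.
  by rewrite addSn ltnS leq_addr.
rewrite /expansion_form E normrM (@ger0_norm _ (m`!%:R^-1))// normrM normfV normrX (gtr0_norm a0).
rewrite ler_pdivrMr ?ltr0n ?fact_gt0//.
apply: le_trans (_ : (a ^+ m)^-1 * (2 ^+ m * N ^+ m.+1) <= _).
  by rewrite ler_wpM2l// invr_ge0 exprn_ge0// ltW.
have -> : (a ^+ m)^-1 * (2 ^+ m * N ^+ m.+1) = m.+1%:R ^+ m * (4 / e) ^+ m * N ^+ m.+1.
  rewrite -exprVn mulrA -exprMn -[in RHS]exprMn; congr (_ ^+ m * _).
  by rewrite /a; field; rewrite lt0r_neq0//= addrC natr1 pnatr_eq0.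
rewrite [leRHS](_ : _ = 4 ^+ m.+1 * m`!%:R * (1 + 4 / e) ^+ m.+1 * N ^+ m.+1); last first.
  by rewrite !exprMn; ring.
rewrite ler_wpM2r ?exprn_ge0// ler_pM ?exprn_ge0 ?divr_ge0 ?(ltW e0)//.
  have := expn_leq_fact m.+1; rewrite expnS factS mulnCA leq_mul2l /= => H.
  by rewrite -!natrX -natrM ler_nat.
have e4 : 0 <= 4 / e by rewrite divr_ge0// ltW.
apply: le_trans (_ : (1 + 4 / e) ^+ m <= _).
  by rewrite lerXn2r ?nnegrE ?addr_ge0// lerDr.
by rewrite ler_weXn2l// lerDl.
Qed.

(** Each argument w is replaced by its largest natural multiple n w in the unit ball. Additivity
    extracts the factor 1/n, and 1/n <= 2 |w|; hence one 2 per argument, collected in the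
    constant. *)
Let form_bound : exists2 K : R, 0 <= K & forall m (s : seq X), size s = m ->
  all (fun w : X => `|w| <= 1) s -> `|expansion_form m s| <= K ^+ m.+1 * \prod_(w <- s) `|w|.
Proof.
have [K K0 HK] := form_bound1.
exists (2 * K) => [|m s sm s1]; first by rewrite mulr_ge0.
suff main (pre t : seq X) : size (pre ++ t) = m -> all (fun w : X => `|w| <= 1) (pre ++ t) ->
    `|expansion_form m (pre ++ t)| <= K ^+ m.+1 * \prod_(w <- t) (2 * `|w|).
  apply: le_trans (main [::] s sm s1) _.
  rewrite [leRHS](_ : _ = K ^+ m.+1 * (2 ^+ m.+1 * \prod_(w <- s) `|w|)); last first.
    by rewrite exprMn; ring.
  rewrite ler_wpM2l ?exprn_ge0//.
  have -> : \prod_(w <- s) (2 * `|w|) = 2 ^+ m * \prod_(w <- s) `|w|.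
    rewrite -sm; elim: (s) => [|w t IH]; first by rewrite !big_nil expr0 mul1r.
    by rewrite !big_cons IH /= exprS; ring.
  by rewrite ler_wpM2r ?prodr_ge0// exprS ler_peMl ?exprn_ge0// ler1n.
elim: t pre => [|w t IH] pre.
  by rewrite cats0 big_nil mulr1 => *; exact: HK.
move=> sz; rewrite all_cat /= => /and3P[pre1 w1 t1]; rewrite big_cons.
have szm : (size pre + size t).+1 = m by rewrite -sz size_cat addnS.
have form0 : expansion_form m (pre ++ 0 :: t) = 0.
  have := form_additive 0 0 szm; rewrite addr0 => /eqP.
  by rewrite -subr_eq0 opprD addrA subrr sub0r oppr_eq0 => /eqP.
have [->|wn0] := eqVneq w 0; first by rewrite form0 !normr0 mulr0 mul0r mulr0.
have w0 : 0 < `|w| by rewrite normr_gt0.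
pose n := Num.truncn `|w|^-1.
have /andP[nw wn] : n%:R <= `|w|^-1 < n.+1%:R by rewrite truncn_itv// invr_ge0.
have n1 : (0 < n)%N by rewrite truncn_gt0 invf_ge1.
have formn k : expansion_form m (pre ++ (w *+ k) :: t) = k%:R * expansion_form m (pre ++ w :: t).
  elim: k => [|k IHk]; first by rewrite mulr0n mul0r form0.
  by rewrite mulrS form_additive// IHk -[in RHS]nat1r mulrDl mul1r.
have nR : 0 < n%:R :> R by rewrite ltr0n.
rewrite -(ler_pM2l nR) -[X in X * `|_| <= _](@ger0_norm _ n%:R)// -normrM -formn -cat_rcons.
apply: le_trans (IH _ _ _) _.
- by rewrite cat_rcons size_cat /= addnS -szm.
- rewrite cat_rcons all_cat pre1 /= t1 andbT normrMn -[leLHS]mulr_natl.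
  by rewrite -ler_pdivlMr// mul1r.
rewrite mulrCA ler_wpM2l ?exprn_ge0// mulrA ler_peMl//.
  by apply: prodr_ge0 => i _; rewrite mulr_ge0.
have : 1 <= n.+1%:R * `|w| by rewrite -ler_pdivrMr// mul1r ltW.
have : n.+1%:R * `|w| <= (n%:R + n%:R) * `|w|.
  by rewrite ler_wpM2r// -natrD ler_nat -addn1 leq_add2l.
by lra.
Qed.

Lemma banach_expansion : exists (A : nat -> seq X -> R) (K d : R),
  [/\ forall m s1 s2 u v, (size s1 + size s2).+1 = m ->
        A m (s1 ++ (u + v) :: s2) = A m (s1 ++ u :: s2) + A m (s1 ++ v :: s2),
      forall m s, size s = m -> all (fun w => `|w| <= 1) s ->
        `|A m s| <= K ^+ m.+1 * \prod_(w <- s) `|w|,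
      0 <= K, 0 < d &
      forall y, `|y| < d -> series (fun m => A m (nseq m y)) @ \oo --> phi y].
Proof.
have [K K0 HK] := form_bound.
(* The last entry gives K |y| <= 1/8, as the summation at the end of the segment from 0 to y
   demands. *)
pose d : R := Num.min r (Num.min 1 (8 * (K + 1))^-1).
have K1 : 0 < 8 * (K + 1) by rewrite mulr_gt0// ltr_wpDl.
have d0 : 0 < d by rewrite !lt_min r0 ltr01 invr_gt0.
exists expansion_form, K, d; split => // y.
rewrite !lt_min => /and3P[yr y1 yK].
have -> : (fun m => expansion_form m (nseq m y)) = p^~ y.
  by apply/funext => m; exact: form_diag.
rewrite -[y in phi y]scale1r.
apply: (@analytic_sum R (fun s => phi (s *: y)) K 8^-1) => //.
  move=> t /andP[t0 t1]; apply: analytic_phi; apply: le_lt_trans yr.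
  by rewrite normrZ ger0_norm// ler_piMl.
move=> k; rewrite -/(p k y) -form_diag.
apply: le_trans (HK k _ (size_nseq _ _) _) _; first by rewrite all_nseq (ltW y1) orbT.
have -> : \prod_(w <- nseq k y) `|w| = `|y| ^+ k.
  by elim: (k) => [|j IH]; [rewrite big_nil expr0|rewrite /= big_cons IH exprS].
rewrite exprS -mulrA ler_wpM2l// -exprMn.
rewrite lerXn2r ?nnegrE ?mulr_ge0//.
have : `|y| * (8 * (K + 1)) <= 1 by rewrite -ler_pdivlMr// mul1r ltW.
by have := normr_ge0 y; lra.
Qed.

End BanachExpansion.

(** * Dual pairs *)

Section DualPairFacts.
Context {R : realType} {E : lmodType R}.
Variable E' : set (E -> R).
Hypotheses (dpE : dual_pair E') (completeE : dp_complete E').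

Lemma dual_pair_linear l : E' l ->
  [/\ l 0 = 0, forall x y, l (x + y) = l x + l y,
      forall x y, l (x - y) = l x - l y & forall (a : R) x, l (a *: x) = a * l x].
Proof.
move=> /(dual_pair_scalar dpE) lin.
have l0 : l 0 = 0 by have := lin (-1) 0 0; rewrite scaler0 addr0 mulN1r addrC subrr.
split=> // [x y|x y|a x].
- by have := lin 1 x y; rewrite scale1r mul1r.
- by have := lin (-1) y x; rewrite scaleN1r mulN1r [- y + x]addrC [RHS]addrC.
- by have := lin a x 0; rewrite !addr0 l0 addr0.
Qed.

Lemma analytic_fun_smooth (g : R -> R) : analytic_fun g -> smooth_fun g.
Proof.
move=> ag n t; have /analytic_atP[M [C [d [_ _ d0 H]]]] := ag t.
by apply: (H n t _).1; rewrite subrr normr0.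
Qed.

Lemma analytic_curve_smooth (c : R -> E) : analytic_curve E' c -> smooth_curve E' c.
Proof. by move=> ac l El; apply: analytic_fun_smooth; exact: ac. Qed.

Lemma complete_banach (B : set E) : dp_bounded E' B ->
  exists (X : completeNormedModType R) (i : {linear X -> E}),
    [/\ injective i, forall b, B b -> exists2 x, i x = b & `|x| <= 1 &
        forall l, E' l -> exists C : R, forall x, `|l (i x)| <= C * `|x|].
Proof.
move=> /completeE[A [BA bA _ [X [i [bij nrm]]]]]; exists X, i.
have [_ inj surj] := bij.
have lb (x : E) : has_lbound [set r : R | 0 < r /\ exists2 y, A y & x = r *: y].
  by exists 0 => r [/ltW].
split.
- by move=> x y; apply: inj; rewrite inE.
- move=> b /BA Ab; have /surj[x _ xb] : linear_span A b.
    by exists 1%N, (fun=> 1), (fun=> b); split => //; rewrite big_ord1 scale1r.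
  exists x => //; rewrite nrm xb; apply: ge_inf => //.
  by split => //; exists b; rewrite // scale1r.
move=> l El; have [l0 lD lB lZ] := dual_pair_linear El.
have [M [_ HM]] := bA l El; pose C := `|M| + 1.
have lA y : A y -> `|l y| <= C.
  by move=> Ay; apply: (HM C); [rewrite /C (le_lt_trans (ler_norm M))// ltrDl|exists y].
have C0 : 0 <= C by rewrite addr_ge0.
exists C => x.
pose S := [set r : R | 0 < r /\ exists2 y, A y & i x = r *: y].
(* The infimum of the empty set is 0 by convention, which here forces |x| = 0. *)
have [S0|/set0P S0] := eqVneq S set0.
  have : `|x| = 0 by rewrite nrm /minkowski_functional -/S S0 inf0.
  by move=> /eqP; rewrite normr_eq0 => /eqP ->; rewrite linear0 l0 !normr0 mulr0.
have hS : has_inf S by split => //; exact: lb.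
apply/ler_addgt0Pr => e e0.
have C1 : 0 < C + 1 by rewrite ltr_wpDl.
have [r [r0 [y Ay xy]] rx] := inf_adherent (divr_gt0 e0 C1) hS.
rewrite xy lZ normrM gtr0_norm//.
apply: le_trans (_ : r * C <= _); first by rewrite ler_wpM2l ?(ltW r0)// lA.
move: rx; rewrite -/(minkowski_functional A (i x)) -nrm => rx.
apply: le_trans (ler_wpM2r C0 (ltW rx)) _.
rewrite mulrDl [_ * C]mulrC lerD2l mulrAC ler_pdivrMr// ler_wpM2l ?(ltW e0)//.
by rewrite lerDl.
Qed.

Variables (X : completeNormedModType R) (i : {linear X -> E}) (U : set E).
Hypothesis bounded_i : forall l, E' l -> exists C : R, forall x, `|l (i x)| <= C * `|x|.
Hypothesis openU : cinfty_open E' U.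

Let smooth_curve_i (x0 : E) (gamma : R -> X) :
  (forall (l : X -> R) (C : R), scalar l -> (forall x, `|l x| <= C * `|x|) ->
    smooth_fun (l \o gamma)) ->
  smooth_curve E' (fun t => x0 + i (gamma t)).
Proof.
move=> sgamma l El; have [l0 lD lB lZ] := dual_pair_linear El.
have [C HC] := bounded_i El.
rewrite (_ : l \o _ = fun t => l x0 + ((l \o i) \o gamma) t); last first.
  by apply/funext => t /=; rewrite lD.
apply: smooth_funD; first exact: smooth_fun_cst.
by apply: (sgamma _ C) => // a x y /=; rewrite linearP lD lZ.
Qed.

(** Otherwise points outside [U] converge fast to [x0]; the special curve through them is at [x0] at
    time 0, so it would have to stay in [U] for small times. *)
Lemma cinfty_open_ball x0 : U x0 ->
  exists2 r : R, 0 < r & forall y, `|y| < r -> U (x0 + i y).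
Proof.
move=> Ux0; apply: contrapT => no_ball.
have bad n : exists z, `|z| <= fast n /\ ~ U (x0 + i z).
  apply: contrapT => no_z; apply: no_ball; exists (fast n); first exact: fast_gt0.
  by move=> y yn; apply: contrapT => nU; apply: no_z; exists y; split => //; exact: ltW.
have [z Hz] := choice bad.
pose u (n : nat) : X := 0.
have sc : smooth_curve E' (fun t => x0 + i (special_curve z u t)).
  apply: smooth_curve_i => l C lin lC.
  apply: (smooth_special_curve lin lC) => n; first by have [] := Hz n.
  by rewrite normr0 ltW// fast_gt0.
have := openU sc; rewrite openE => /(_ 0); rewrite /= special_curve0 linear0 addr0.
move=> /(_ Ux0); rewrite /interior /= => /nbhs_ballP[e /= e0 He].
have /cvgrPdist_lt /(_ e e0) [n _ /(_ n (leqnn n))] := @cvg_half R.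
move=> /= ne; have [_] := Hz n; apply.
have /He /= : ball (0 : R) e (2^-1 ^+ n) by [].
have := @special_curve_plateau R X z u n 0; rewrite normr0 addr0 mulr1 scale0r addr0.
by move=> ->.
Qed.

Lemma dual_pair_expansion (psi : E -> R) x0 :
  (forall c, smooth_curve E' c -> range c `<=` U -> smooth_fun (psi \o c)) ->
  (forall x v, U x -> forall t : R, U (x + t *: v) ->
    analytic_at (fun s : R => psi (x + s *: v)) t) -> U x0 ->
  exists (A : nat -> seq X -> R) (K d : R),
  [/\ forall m s1 s2 u v, (size s1 + size s2).+1 = m ->
        A m (s1 ++ (u + v) :: s2) = A m (s1 ++ u :: s2) + A m (s1 ++ v :: s2),
      forall m s, size s = m -> all (fun w => `|w| <= 1) s ->
        `|A m s| <= K ^+ m.+1 * \prod_(w <- s) `|w|,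
      0 <= K, 0 < d &
      forall y, `|y| < d -> series (fun m => A m (nseq m y)) @ \oo --> psi (x0 + i y)].
Proof.
move=> spsi apsi Ux0; have [r r0 Ur] := cinfty_open_ball Ux0.
apply: (@banach_expansion R X (fun y => psi (x0 + i y)) r r0).
  move=> gamma sgamma rgamma; apply: (spsi (fun t => x0 + i (gamma t))).
    exact: smooth_curve_i.
  by move=> _ [t _ <-]; apply: Ur.
move=> v t tv; under eq_fun do rewrite linearZ.
by apply: apsi => //; have := Ur _ tv; rewrite linearZ.
Qed.

End DualPairFacts.

(** * Composition with real analytic curves *)

Section AnalyticAlongCurves.
Context {R : realType} {E : lmodType R}.
Variables (E' : set (E -> R)) (U : set E) (psi : E -> R).
Hypotheses (dpE : dual_pair E') (completeE : dp_complete E') (openU : cinfty_open E' U).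
Hypothesis smooth_psi :
  forall c, smooth_curve E' c -> range c `<=` U -> smooth_fun (psi \o c).
Hypothesis analytic_psi : forall x v, U x -> forall t : R, U (x + t *: v) ->
  analytic_at (fun s : R => psi (x + s *: v)) t.
Variables (c : R -> E) (t0 : R) (k : nat -> nat) (a tau : nat -> R).
Hypotheses (ac : analytic_curve E' c) (cU : range c `<=` U).
Hypothesis ka_near : forall n, `|a n - t0| < n.+1%:R^-1.
Hypothesis tau_gt0 : forall n, 0 < tau n.
(** Besides keeping the nodes near [t0], the square makes k (n + 1) tau at most 1/(n + 1), as the
    Cauchy estimate with constant n + 1 will require. *)
Hypothesis tau_small : forall n, tau n * (n.+1%:R * n.+1%:R) * (k n).+1%:R <= 1.

Let node n j : R := a n + tau n *+ j.
Let quotient n j : E := (node n j - t0)^-1 *: (c (node n j) - c t0).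
Let difference n j : E :=
  (tau n ^+ j * j`!%:R * n.+1%:R ^+ j)^-1 *: fdiff (nseq j (tau n)) c (a n).

(** The quotients turn closeness of a node to [t0] into smallness in norm. At a node equal to [t0]
    the inverse is 0, and so is the quotient. The index j = 0 is excluded from the differences
    because that coefficient comes from the quotient at the first node. *)
Let B : set E := [set x | exists n j, (j <= k n)%N /\
  (x = quotient n j \/ (0 < j)%N /\ x = difference n j)].

Let node_near n j : (j <= k n)%N -> `|node n j - t0| < 2 / n.+1%:R /\ tau n *+ j <= n.+1%:R^-1.
Proof.
move=> jk; have n0 : 0 < n.+1%:R :> R by [].
have tj : tau n *+ j <= n.+1%:R^-1.
  rewrite -[leLHS]mulr_natr -[leRHS]mul1r ler_pdivlMr//.
  apply: le_trans (tau_small n); rewrite -!mulrA ler_wpM2l ?(ltW (tau_gt0 n))//.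
  rewrite mulrA [leRHS]mulrC ler_pM//; first by rewrite ler_nat leqW.
  by rewrite ler_peMl// ler1n.
split=> //; rewrite /node addrAC; apply: le_lt_trans (ler_normD _ _) _.
rewrite (@ger0_norm _ (tau n *+ j)) ?mulrn_wge0 ?(ltW (tau_gt0 n))//.
by rewrite mulr2n mulrDl mul1r ltr_leD// ka_near.
Qed.

Let bounded_B : dp_bounded E' B.
Proof.
move=> l El; have [l0 lD lB lZ] := dual_pair_linear dpE El.
have /analytic_atP[M [C [d [M0 C0 d0 H]]]] := ac El t0.
have lcl n j : l (fdiff (nseq j (tau n)) c (a n)) = fdiff (nseq j (tau n)) (l \o c) (a n).
  by apply: fdiff_comp => x y; exact: lB.
(* From [N] on the nodes lie where the bounds hold and n + 1 dominates [C]; the finitely many other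
   vectors enter [T] directly. *)
pose N := Num.truncn (C + 2 / d).
have large n j : (N <= n)%N -> (j <= k n)%N ->
    `|l (quotient n j)| <= M * C /\ ((0 < j)%N -> `|l (difference n j)| <= M).
  move=> Nn jk.
  have nCd : C + 2 / d < n.+1%:R.
    by apply: lt_le_trans (_ : N.+1%:R <= _); [exact: truncnS_gt|rewrite ler_nat].
  have nd : 2 / n.+1%:R < d.
    rewrite ltr_pdivrMr// mulrC -ltr_pdivrMr//; apply: le_lt_trans nCd.
    by rewrite lerDr ltW.
  have nC : C <= n.+1%:R.
    by apply: ltW; apply: le_lt_trans nCd; rewrite lerDl divr_ge0// ltW.
  have [nodet0 tj] := node_near jk.
  split.
    rewrite /quotient lZ lB normrM normfV.
    have [->|nn0] := eqVneq (node n j) t0.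
      by rewrite subrr normr0 invr0 mul0r mulr_ge0// ltW.
    rewrite ler_pdivrMl ?normr_gt0 ?subr_eq0//.
    apply: (@mvt_norm_sym R (l \o c) (derive1n 1 (l \o c))) => z zn.
      apply: (@is_derive1n R (l \o c) 0); apply: (H 0 z _).1.
      by apply: le_lt_trans zn _; apply: lt_trans nodet0 nd.
    move=> _; have := (H 1 z _).2; rewrite expr1 factS fact0 mulr1; apply.
    by apply: le_lt_trans zn _; apply: lt_trans nodet0 nd.
  have between x : a n <= x <= node n j -> `|x - t0| < d.
    move=> /andP[ax xn]; apply: lt_trans nd; rewrite -(subrK (a n) x) -addrA.
    apply: le_lt_trans (ler_normD _ _) _; rewrite mulr2n mulrDl mul1r.
    rewrite ler_ltD ?ka_near// ger0_norm ?subr_ge0//; apply: le_trans tj.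
    by rewrite lerBlDl.
  move=> j0; rewrite /difference lZ lcl normrM.
  have p0 : 0 < tau n ^+ j * j`!%:R * n.+1%:R ^+ j.
    by rewrite !mulr_gt0 ?exprn_gt0 ?ltr0n ?fact_gt0.
  rewrite gtr0_norm ?invr_gt0// ler_pdivrMl//.
  apply: le_trans (_ : tau n ^+ j * (M * C ^+ j * j`!%:R) <= _).
    apply: (@fdiff_norm R j (fun q => derive1n q (l \o c)) (a n) (node n j)).
    - exact: ltW.
    - by [].
    - by move=> q x xn; apply: is_derive1n; exact: (H q x (between x xn)).1.
    - by move=> x xn; exact: (H j x (between x xn)).2.
  rewrite [leRHS](_ : _ = tau n ^+ j * (M * n.+1%:R ^+ j * j`!%:R)); last by ring.
  rewrite ler_wpM2l ?exprn_ge0 ?(ltW (tau_gt0 n))// ler_wpM2r// ler_wpM2l//.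
  by rewrite lerXn2r ?nnegrE ?(ltW C0).
pose T : R := M * C + M + \sum_(n < N) \sum_(j < (k n).+1) (`|l (quotient n j)| + `|l (difference n j)|).
have T0 : 0 <= \sum_(n < N) \sum_(j < (k n).+1) (`|l (quotient n j)| + `|l (difference n j)|).
  by apply: sumr_ge0 => n _; apply: sumr_ge0 => j _; rewrite addr_ge0.
have MC0 : 0 <= M * C by rewrite mulr_ge0// ltW.
suff main n j : (j <= k n)%N -> `|l (quotient n j)| <= T /\ ((0 < j)%N -> `|l (difference n j)| <= T).
  exists T; split; first exact: num_real.
  move=> y Ty _ [x [n [j [jk [->|[j0 ->]]]]] <-] /=; apply: le_trans (ltW Ty);
    have [H1 H2] := main n j jk; [exact: H1|exact: H2].
move=> jk; have [nN|Nn] := ltnP n N; last first.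
  have [H1 H2] := large n j Nn jk; split.
    by apply: le_trans H1 _; rewrite /T -addrA lerDl addr_ge0.
  by move=> /H2 H3; apply: le_trans H3 _; rewrite /T addrAC lerDr addr_ge0.
have : `|l (quotient n j)| + `|l (difference n j)| <= T.
  rewrite /T; apply: le_trans (_ : \sum_(n < N) \sum_(j < (k n).+1)
    (`|l (quotient n j)| + `|l (difference n j)|) <= _); last by rewrite lerDr addr_ge0.
  rewrite (bigD1 (Ordinal nN))//= (bigD1 (Ordinal (jk : (j < (k n).+1)%N)))//= -!addrA.
  rewrite lerD2l lerDl addr_ge0//; first by apply: sumr_ge0 => q _; rewrite addr_ge0.
  by apply: sumr_ge0 => q _; apply: sumr_ge0 => q' _; rewrite addr_ge0.
move=> H1; split => [|_]; apply: le_trans H1; [by rewrite lerDl|by rewrite lerDr].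
Qed.

Lemma fdiff_along_curve : exists K C n0, 0 <= K /\ forall n, (n0 <= n)%N ->
  `|fdiff (nseq (k n) (tau n)) (psi \o c) (a n)| <=
  tau n ^+ k n * (k n)`!%:R * (K * (C * n.+1%:R) ^+ k n).
Proof.
have [X [i [inj Bi il]]] := complete_banach dpE completeE bounded_B.
have Uc t : U (c t) by apply: cU; exists t.
have [A [K [d [Aadd Abd K0 d0 Acvg]]]] :=
  dual_pair_expansion dpE il openU smooth_psi analytic_psi (Uc t0).
have K1 : 0 < 8 * (K + 1) by rewrite mulr_gt0// ltr_wpDl.
(* With eta <= sigma this gives K (eta + 2 sigma) <= 3/8, below the required 1/2. *)
pose sigma := (8 * (K + 1))^-1.
have sigma0 : 0 < sigma by rewrite invr_gt0.
have Ks0 : 0 <= K * sigma by rewrite mulr_ge0// ltW.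
have sigma8 : 8 * (K * sigma + sigma) = 1.
  have E8 (s : R) : 8 * (K * s + s) = s * (8 * (K + 1)) by ring.
  by rewrite E8 mulVf// gt_eqF.
pose n0 := Num.truncn (sigma^-1 + 2 / d).
exists (2 * K), (8 / sigma), n0; split => [|n nn0]; first by rewrite mulr_ge0.
have nsd : sigma^-1 + 2 / d < n.+1%:R.
  by apply: lt_le_trans (_ : n0.+1%:R <= _); [exact: truncnS_gt|rewrite ler_nat].
have ns : n.+1%:R^-1 <= sigma.
  rewrite -[sigma]invrK lef_pV2 ?posrE ?invr_gt0// ltW// (le_lt_trans _ nsd)//.
  by rewrite lerDl divr_ge0// ltW.
have nd : 2 / n.+1%:R < d.
  rewrite ltr_pdivrMr// mulrC -ltr_pdivrMr//; apply: le_lt_trans nsd.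
  by rewrite lerDr ltW// invr_gt0.
have getY j : exists y, (j <= k n)%N -> i y = c (node n j) - c t0 /\ `|y| <= `|node n j - t0|.
  have [jk|kj] := leqP j (k n); last by exists 0.
  have [|x ix x1] := Bi (quotient n j); first by exists n, j; split => //; left.
  exists ((node n j - t0) *: x) => _; split; last by rewrite normrZ ler_piMr.
  rewrite linearZ /= ix scalerA; have [->|nn] := eqVneq (node n j) t0.
    by rewrite subrr mul0r scale0r subrr.
  by rewrite mulfV ?scale1r// subr_eq0.
have [Y HY] := choice getY.
have getW j : exists w, (0 < j <= k n)%N -> i w = fdiff (nseq j (tau n)) c (a n) /\
    `|w| <= tau n ^+ j * j`!%:R * n.+1%:R ^+ j.
  have [/andP[j0 jk]|] := boolP (0 < j <= k n)%N; last by exists 0.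
  have [|x ix x1] := Bi (difference n j); first by exists n, j; split => //; right.
  have p0 : 0 < tau n ^+ j * j`!%:R * n.+1%:R ^+ j.
    by rewrite !mulr_gt0 ?exprn_gt0 ?ltr0n ?fact_gt0.
  exists ((tau n ^+ j * j`!%:R * n.+1%:R ^+ j) *: x) => _; split.
    by rewrite linearZ /= ix scalerA mulfV ?scale1r// gt_eqF.
  by rewrite normrZ gtr0_norm// ler_piMr// ltW.
have [W' HW'] := choice getW.
(* Subtracting the constant c t0 changes only the Newton coefficient of order 0. The formula holds
   in [E] and is pulled back to [X] by injectivity of [i]. *)
pose W j := if j is 0%N then Y 0%N else W' j.
have YW j : (j <= k n)%N -> Y j = \sum_(q < (k n).+1) W q *+ 'C(j, q).
  move=> jk; apply: inj; rewrite (HY j jk).1 linear_sum /= /node.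
  rewrite (fdiff_newton (tau n) c (a n) jk) !big_ord_recl /= !bin0 !mulr1n.
  rewrite (HY 0%N isT).1 /node mulr0n addr0 addrAC; congr (_ + _).
  apply: eq_bigr => q _; rewrite raddfMn /=; congr (_ *+ _).
  have qk : (0 < q.+1 <= k n)%N by exact: ltn_ord.
  by have [] := HW' q.+1 qk.
rewrite fdiff_altsum [8 / sigma * _]mulrAC.
apply: (@altsum_series_fact_bound R X A K Aadd Abd W (k n) (n.+1%:R^-1) sigma n.+1%:R (tau n)) => //.
- by lra.
- exact: ltW.
- apply: le_trans ns; rewrite -[leRHS]mul1r ler_pdivlMr//.
  apply: le_trans (tau_small n).
  rewrite [leLHS](_ : _ = tau n * (n.+1%:R * n.+1%:R) * (k n)%:R); last by ring.
  by rewrite ler_wpM2l ?ler_nat// !mulr_ge0// ltW.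
- apply: le_trans (_ : K * (sigma + 2 * sigma) <= _).
    by rewrite ler_wpM2l// lerD2r.
  have E3 (s : R) : K * (s + 2 * s) = 3 * (K * s) by ring.
  by rewrite E3; lra.
- by rewrite invf_le1// ler1n.
- rewrite /W; apply: le_trans (HY 0%N isT).2 _.
  by rewrite /node mulr0n addr0 ltW// ka_near.
- by case=> // j jk; exact: (HW' j.+1 jk).2.
move=> j jk; rewrite -(YW j jk) /=.
have := Acvg (Y j); rewrite (HY j jk).1 addrC subrK; apply.
by apply: le_lt_trans (HY j jk).2 _; apply: lt_trans nd; exact: (node_near jk).1.
Qed.

End AnalyticAlongCurves.

Lemma analytic_along_analytic_curve (R : realType) (E : lmodType R)
    (E' : set (E -> R)) (U : set E) (psi : E -> R) (c : R -> E) :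
  dual_pair E' -> dp_complete E' -> cinfty_open E' U ->
  (forall c, smooth_curve E' c -> range c `<=` U -> smooth_fun (psi \o c)) ->
  (forall x v, U x -> forall t : R, U (x + t *: v) ->
    analytic_at (fun s : R => psi (x + s *: v)) t) ->
  analytic_curve E' c -> range c `<=` U -> analytic_fun (psi \o c).
Proof.
move=> dpE completeE openU spsi apsi ac cU t0; apply: contrapT => not_analytic.
have sg : smooth_fun (psi \o c) by apply: spsi => //; exact: analytic_curve_smooth.
have bad n : exists kat : nat * (R * R), let: (k, (a, tau)) := kat in
    [/\ `|a - t0| < n.+1%:R^-1, 0 < tau, tau * (n.+1%:R * n.+1%:R) * k.+1%:R <= 1 &
      tau ^+ k * (n.+1%:R * (n.+1%:R * n.+1%:R) ^+ k * k`!%:R) <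
      `|fdiff (nseq k tau) (psi \o c) a|].
  apply: contrapT => no_bad; apply: not_analytic.
  (* The estimate along the curve will be K (C (n + 1))^k up to tau^k k!; n + 1 eventually exceeds
     K, and its square exceeds C (n + 1). *)
  apply: (@smooth_analytic R (psi \o c) t0 n.+1%:R (n.+1%:R * n.+1%:R) n.+1%:R^-1) => //.
  move=> k a an e e0; apply: contrapT => no_tau; apply: no_bad.
  pose D : R := (n.+1%:R * n.+1%:R) * k.+1%:R.
  have D0 : 0 < D by rewrite !mulr_gt0.
  pose tau := Num.min (e / 2) D^-1.
  have tau0 : 0 < tau by rewrite lt_min divr_gt0// invr_gt0.
  have taue : tau < e by rewrite gt_min; apply/orP; left; lra.
  exists (k, (a, tau)); split => //.
    by rewrite -mulrA -/D -ler_pdivlMr// mul1r ge_min lexx orbT.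
  by rewrite ltNge; apply/negP => le_fd; apply: no_tau; exists tau.
have [kat Hkat] := choice bad.
pose k n := (kat n).1; pose a n := (kat n).2.1; pose tau n := (kat n).2.2.
have H n : [/\ `|a n - t0| < n.+1%:R^-1, 0 < tau n,
      tau n * (n.+1%:R * n.+1%:R) * (k n).+1%:R <= 1 &
      tau n ^+ k n * (n.+1%:R * (n.+1%:R * n.+1%:R) ^+ k n * (k n)`!%:R) <
      `|fdiff (nseq (k n) (tau n)) (psi \o c) (a n)|].
  by rewrite /k /a /tau; have := Hkat n; case: (kat n) => k' [a' tau'].
have [K [C [n0 [K0 HK]]]] := @fdiff_along_curve R E E' U psi dpE completeE openU
  spsi apsi c t0 k a tau ac cU (fun n => let: And4 h _ _ _ := H n in h)
  (fun n => let: And4 _ h _ _ := H n in h) (fun n => let: And4 _ _ h _ := H n in h).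
pose n := maxn n0 (Num.truncn (K + `|C|)).
have nKC : K + `|C| < n.+1%:R.
  apply: lt_le_trans (_ : (Num.truncn (K + `|C|)).+1%:R <= _); first exact: truncnS_gt.
  by rewrite ler_nat ltnS leq_maxr.
have [_ tau0 _] := H n; rewrite ltNge => /negP; apply.
apply: le_trans (HK n (leq_maxl _ _)) _.
rewrite -mulrA ler_wpM2l ?exprn_ge0 ?(ltW tau0)// mulrC ler_wpM2r//.
have nK : K <= n.+1%:R by apply: ltW; apply: le_lt_trans nKC; rewrite lerDl.
have nC : `|C| <= n.+1%:R by apply: ltW; apply: le_lt_trans nKC; rewrite lerDr.
apply: le_trans (_ : K * (`|C| * n.+1%:R) ^+ k n <= _).
  by rewrite ler_wpM2l// (le_trans (ler_norm _))// normrX normrM (@ger0_norm _ n.+1%:R).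
rewrite ler_pM ?exprn_ge0 ?mulr_ge0// lerXn2r ?nnegrE ?mulr_ge0//.
by rewrite ler_wpM2r.
Qed.

(** * The logistic function and its inverse *)

Section Logistic.
Context {R : realType}.
Implicit Types (p : {poly R}) (x s u : R).

Definition logistic s : R := (1 + expR (- s))^-1.

Let den_gt0 s : 0 < 1 + expR (- s).
Proof. by rewrite addr_gt0// expR_gt0. Qed.

Lemma logistic_itv s : 0 < logistic s < 1.
Proof.
by rewrite invr_gt0 den_gt0 invf_lt1 ?den_gt0// ltrDl expR_gt0.
Qed.

Let is_derive_logistic s : is_derive s 1 logistic (logistic s - logistic s ^+ 2).
Proof.
have dN : is_derive s 1 (fun y : R => - y) (-1) by apply: is_deriveN; exact: is_derive_id.
have de : is_derive s 1 (fun y : R => expR (- y)) (expR (- s) * -1).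
  exact: (is_derive1_comp (is_derive_expR _) dN).
have dd : is_derive s 1 (fun y : R => 1 + expR (- y)) (0 + expR (- s) * -1).
  exact: is_deriveD.
have dV := @is_deriveV R (fun y => 1 + expR (- y)) s _ 1 (lt0r_neq0 (den_gt0 s)) dd.
apply: (is_derive_eq dV).
rewrite /logistic /GRing.scale /= add0r exprVn.
by have := lt0r_neq0 (den_gt0 s); move: (expR _) => e e0; field.
Qed.

Let coef_norm n p := \sum_(i < n) `|p`_i|.

Let horner_coef_norm n p x : (size p <= n)%N -> 0 <= x <= 1 -> `|p.[x]| <= coef_norm n p.
Proof.
move=> pn /andP[x0 x1]; rewrite (horner_coef_wide _ pn).
apply: le_trans (ler_norm_sum _ _ _) _; apply: ler_sum => j _.
by rewrite normrM ler_piMr// normrX ger0_norm// exprn_ile1.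
Qed.

Let coef_norm_deriv n p : coef_norm n p^`() <= n%:R * coef_norm n.+1 p.
Proof.
rewrite /coef_norm big_ord_recl mulrDr ler_wpDl ?mulr_ge0// mulr_sumr.
apply: ler_sum => j _; rewrite coef_deriv normrMn -[leLHS]mulr_natl ler_wpM2r//.
by rewrite ler_nat.
Qed.

Let coef_norm_mul n p : (size p <= n)%N ->
  coef_norm n.+2 (p * ('X - 'X^2)) <= 2 * coef_norm n p.
Proof.
move=> pn; rewrite mulrBr /coef_norm.
have X1 : \sum_(i < n.+2) `|(p * 'X)`_i| = \sum_(i < n) `|p`_i|.
  rewrite big_ord_recl coefMX normr0 add0r big_ord_recr /= coefMX /=.
  rewrite (nth_default _ pn) normr0 addr0.
  by apply: eq_bigr => j _; rewrite coefMX.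
have X2 : \sum_(i < n.+2) `|(p * 'X^2)`_i| = \sum_(i < n) `|p`_i|.
  rewrite big_ord_recl coefMXn normr0 add0r big_ord_recl /= coefMXn normr0 add0r.
  by apply: eq_bigr => j _; rewrite coefMXn /= subSS subSS subn0.
rewrite mulr_natl mulr2n -{1}X1 -X2 -big_split /=; apply: ler_sum => j _.
by rewrite coefB ler_normB.
Qed.

(** Since L' = L - L^2, each derivative of L is a polynomial in L, with L in (0, 1). On the sum of
    absolute coefficients, multiplying by X - X^2 costs at most 2 and the derivation at most the
    degree; hence 2^k k!. *)
Let logistic_poly k : {poly R} := iter k (fun p => p^`() * ('X - 'X^2)) 'X.

Let logistic_poly_bound k : (size (logistic_poly k) <= k.+2)%N /\
  coef_norm k.+2 (logistic_poly k) <= 2 ^+ k * k`!%:R.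
Proof.
elim: k => [|k [szk Nk]].
  by rewrite size_polyX /coef_norm /= !big_ord_recl big_ord0 !coefX /= normr0 normr1 add0r addr0 mulr1.
have szd : (size (logistic_poly k)^`() <= k.+1)%N.
  have [->|p0] := eqVneq (logistic_poly k) 0; first by rewrite deriv0 size_poly0.
  by rewrite -ltnS (leq_trans (lt_size_deriv p0)).
rewrite /logistic_poly iterS -/(logistic_poly k); split.
  apply: leq_trans (size_polyMleq _ _) _.
  have szX : (size ('X - 'X^2 : {poly R})%R <= 3)%N.
    by rewrite (leq_trans (size_polyD _ _))// size_polyN size_polyX size_polyXn.
  by have := leq_add szd szX; rewrite addn3; case: (_ + _)%N.
apply: le_trans (coef_norm_mul szd) _.
rewrite exprS factS natrM -mulrA ler_wpM2l//.
apply: le_trans (coef_norm_deriv _ _) _.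
by rewrite mulrCA ler_wpM2l.
Qed.

Let logistic_tower k : forall s,
  is_derive s 1 (fun y => (logistic_poly k).[logistic y]) (logistic_poly k.+1).[logistic s].
Proof.
move=> s; have := is_derive1_comp (is_derive_poly (logistic_poly k) (logistic s)) (is_derive_logistic s).
move=> H; apply: (is_derive_eq H).
by rewrite /logistic_poly iterS hornerM hornerD hornerN hornerX hornerXn.
Qed.

Lemma analytic_logistic (p q : R) : analytic_fun (fun s => p + q * logistic s).
Proof.
move=> t; pose D k s : R := (if k is 0%N then p else 0) + q * (logistic_poly k).[logistic s].
have -> : (fun s => p + q * logistic s) = D 0%N.
  by apply/funext => s; rewrite /D /= hornerX.
apply: (@tower_analytic R D t 1 (`|p| + `|q|) 2) => // [k s _|k s _].
  have Hq : is_derive s 1 (fun y => q * (logistic_poly k).[logistic y])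
    (q * (logistic_poly k.+1).[logistic s]) by exact: (is_deriveZ q (logistic_tower k s)).
  exact: (is_deriveD (is_derive_cst (if k is 0%N then p else 0) s 1) Hq).
have /andP[L0 L1] := logistic_itv s.
have [szk Nk] := logistic_poly_bound k.
have Lk : `|(logistic_poly k).[logistic s]| <= 2 ^+ k * k`!%:R.
  by apply: le_trans Nk; apply: horner_coef_norm; rewrite // (ltW L0) (ltW L1).
rewrite /D -mulrA mulrDl; apply: le_trans (ler_normD _ _) _.
rewrite lerD//; last by rewrite normrM ler_wpM2l.
case: k {szk Nk Lk} => [|k]; first by rewrite expr0 mulr1 mulr1.
by rewrite normr0 !mulr_ge0 ?exprn_ge0.
Qed.

Definition logit u : R := ln (2^-1 + u) - ln (2^-1 - u).

Lemma logistic_logit u : `|u| < 2^-1 -> logistic (logit u) = 2^-1 + u.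
Proof.
rewrite ltr_norml => /andP[u1 u2]; have p1 : 0 < 2^-1 + u by lra.
have p2 : 0 < 2^-1 - u by lra.
rewrite /logistic /logit opprB expRB lnK ?posrE// lnK ?posrE//.
have -> : 1 + (2^-1 - u) / (2^-1 + u) = (2^-1 + u)^-1.
  by field; rewrite gt_eqF//; lra.
by rewrite invrK.
Qed.

Lemma logit0 : logit 0 = 0.
Proof. by rewrite /logit addr0 subr0 subrr. Qed.

Let ln_bound x : 4^-1 <= x -> x <= 1 -> `|ln x| <= 3.
Proof.
move=> x4 x1; have x0 : 0 < x by lra.
rewrite ler0_norm ?ln_le0// -lnV ?posrE//.
apply: le_trans (_ : x^-1 - 1 <= _).
  have := @le_ln1Dx R (x^-1 - 1); rewrite [1 + _]addrC subrK; apply.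
  by rewrite ltrBrDl subrr invr_gt0.
have : x^-1 <= 4 by rewrite -[4]invrK lef_pV2 ?posrE ?invr_gt0.
by lra.
Qed.

Lemma analytic_logit : analytic_at logit 0.
Proof.
pose D k u : R := if k is j.+1 then
  j`!%:R * ((-1) ^+ j * (2^-1 + u)^-1 ^+ j.+1 + (2^-1 - u)^-1 ^+ j.+1) else logit u.
(* For |u| < 1/4 both 1/2 + u and 1/2 - u exceed 1/4, which gives the rate 4; the factor 8 also
   covers |logit u| <= 6. *)
apply: (@tower_analytic R D 0 4^-1 8 4) => // k u; rewrite subr0 ltr_norml => /andP[u1 u2].
  have p1 : 0 < 2^-1 + u by lra.
  have p2 : 0 < 2^-1 - u by lra.
  have d1 : is_derive u 1 (fun y : R => 2^-1 + y) 1.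
    by have := is_deriveD (is_derive_cst (2^-1 : R) u 1) (is_derive_id u 1); rewrite add0r.
  have d2 : is_derive u 1 (fun y : R => 2^-1 - y) (-1).
    by have := is_deriveB (is_derive_cst (2^-1 : R) u 1) (is_derive_id u 1); rewrite sub0r.
  case: k => [|j].
    have l1 := @is_derive1_comp R (@ln R) (fun y => 2^-1 + y) u _ _ (is_derive1_ln p1) d1.
    have l2 := @is_derive1_comp R (@ln R) (fun y => 2^-1 - y) u _ _ (is_derive1_ln p2) d2.
    apply: (is_derive_eq (is_deriveB l1 l2)).
    by rewrite /D fact0 expr0 !expr1; ring.
  have v1 := @is_deriveV R (fun y => 2^-1 + y) u _ 1 (lt0r_neq0 p1) d1.
  have v2 := @is_deriveV R (fun y => 2^-1 - y) u _ 1 (lt0r_neq0 p2) d2.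
  have e1 := is_derive_exp j.+1 v1.
  have e2 := is_derive_exp j.+1 v2.
  have := is_deriveZ (j`!%:R : R) (is_deriveD (is_deriveZ ((-1) ^+ j : R) e1) e2).
  move=> H; apply: (is_derive_eq H).
  rewrite /D /GRing.scale /= factS natrM -!exprVn !mulr1 (exprSr (-1)) !exprSr expr0.
  by move: ((-1) ^+ j) (_^-1 ^+ j) (_^-1 ^+ j); intros; ring.
have p1 : 4^-1 < 2^-1 + u by lra.
have p2 : 4^-1 < 2^-1 - u by lra.
case: k => [|j] /=.
  rewrite /logit expr0 fact0 !mulr1; apply: le_trans (ler_normB _ _) _.
  have := ln_bound (ltW p1); have := ln_bound (ltW p2).
  have q1 : 2^-1 + u <= 1 by lra.
  have q2 : 2^-1 - u <= 1 by lra.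
  by move=> /(_ q2) H1 /(_ q1) H2; lra.
have inv4 (x : R) : 4^-1 < x -> `|x^-1 ^+ j.+1| <= 4 ^+ j.+1.
  move=> x4; have x0 : 0 < x by lra.
  rewrite normrX gtr0_norm ?invr_gt0// lerXn2r ?nnegrE ?invr_ge0 ?(ltW x0)//.
  by rewrite -[4]invrK lef_pV2 ?posrE ?invr_gt0// ltW.
rewrite normrM ger0_norm//.
apply: le_trans (_ : j`!%:R * (4 ^+ j.+1 + 4 ^+ j.+1) <= _).
  rewrite ler_wpM2l// (le_trans (ler_normD _ _))// lerD ?inv4//.
  by rewrite normrM normrX normrN1 expr1n mul1r inv4.
have f1 : j`!%:R <= j.+1`!%:R :> R by rewrite ler_nat factS leq_pmull.
have : j`!%:R * (4 ^+ j.+1 + 4 ^+ j.+1) <= j.+1`!%:R * (4 ^+ j.+1 + 4 ^+ j.+1) :> R.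
  by rewrite ler_wpM2r// addr_ge0 ?exprn_ge0.
move=> /le_trans; apply.
have P : 0 <= 4 ^+ j.+1 * j.+1`!%:R :> R by rewrite mulr_ge0 ?exprn_ge0.
rewrite [leLHS](_ : _ = 2 * (4 ^+ j.+1 * j.+1`!%:R)); last by ring.
by rewrite -mulrA ler_wpM2r//; lra.
Qed.

End Logistic.

Section Composition.
Context {R : realType}.

(* The smoothness of [g] is only used qualitatively: the Cauchy estimate, for
   the forms [b m * w_1 ... w_m] on [R], supplies the bounds. *)
Lemma analytic_at_comp (g q w : R -> R) (r : R) : smooth_fun g ->
  analytic_at q 0 -> analytic_at w 0 -> w 0 = 0 -> 0 < r ->
  (forall u, `|u| < r -> g u = q (w u)) -> analytic_at g 0.
Proof.
move=> sg aq aw w0 r0 gqw.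
pose b m : R := derive1n m q 0 / m`!%:R.
have [K K0 bK] : exists2 K, 0 <= K & forall m, `|b m| <= K ^+ m.+1.
  have /analytic_atP[M [C [d [M0 C0 d0 H]]]] := aq.
  exists (M + C) => [|m]; first by rewrite addr_ge0// ltW.
  have [|_ HM] := H m 0; first by rewrite subrr normr0.
  rewrite /b normf_div [X in _ / X]ger0_norm// ler_pdivrMr ?ltr0n ?fact_gt0//.
  apply: le_trans HM _; rewrite ler_wpM2r// exprS ler_pM ?exprn_ge0 ?(ltW C0)//.
    by rewrite lerDl ltW.
  by rewrite lerXn2r ?nnegrE ?addr_ge0 ?(ltW C0)// lerDr.
have /nbhs_ballP[delta /= delta0 Hq] := analytic_at_taylor aq.
have /analytic_atP[M [C [dw [M0 C0 dw0 H]]]] := aw.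
pose B : R := M * C + 1.
have B0 : 0 < B by rewrite ltr_wpDl// mulr_ge0// ltW.
have wB u : `|u| < dw -> `|w u| <= B * `|u|.
  move=> udw.
  have z_dw (z : R) : `|z - 0| <= `|u - 0| -> `|z - 0| < dw.
    by move=> /le_lt_trans; apply; rewrite subr0.
  have := @mvt_norm_sym R w (derive1n 1 w) u 0 (M * C)
    (fun z zu => @is_derive1n R w 0 z (H 0%N z (z_dw z zu)).1).
  rewrite w0 !subr0 [`|u| * _]mulrC => H1; apply: le_trans (H1 _) _.
    move=> z zu _; have zu0 : `|z - 0| <= `|u - 0| by rewrite (subr0 u).
    have := (H 1%N z (z_dw z zu0)).2.
    by rewrite expr1 factS fact0 muln1 mulr1.
  by rewrite ler_wpM2r// lerDl.
(* The Cauchy estimate admits no prefactor, so M is absorbed: M C^j <= ((M + 1) C)^j for j >= 1. *)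
pose C1 : R := (M + 1) * C.
have C10 : 0 < C1 by rewrite mulr_gt0// ltr_wpDl.
have K1 : 0 < 8 * (K + 1) by rewrite mulr_gt0// ltr_wpDl.
pose sigma : R := (8 * (K + 1))^-1.
have sigma0 : 0 < sigma by rewrite invr_gt0.
have Ks0 : 0 <= K * sigma by rewrite mulr_ge0// ltW.
have sigma8 : 8 * (K * sigma + sigma) = 1.
  have E8 (s : R) : 8 * (K * s + s) = s * (8 * (K + 1)) by ring.
  by rewrite E8 mulVf// gt_eqF.
pose D : R := Num.min (Num.min r dw) (Num.min (sigma / B) (delta / B)).
have D0 : 0 < D by rewrite !lt_min r0 dw0 !divr_gt0.
have DP u : `|u| < D -> [/\ `|u| < r, `|u| < dw, `|w u| < sigma & `|w u| < delta].
  rewrite !lt_min => /andP[/andP[ur ud] /andP[us udelta]]; split => //.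
    by apply: le_lt_trans (wB u ud) _; rewrite mulrC -ltr_pdivlMr.
  by apply: le_lt_trans (wB u ud) _; rewrite mulrC -ltr_pdivlMr.
have D2 : 0 < D / 2 by rewrite divr_gt0.
apply: (@smooth_analytic R g 0 (2 * K) (8 * C1 / sigma) (D / 2)) => //.
  by rewrite mulr_ge0.
  by rewrite divr_gt0// mulr_gt0.
move=> k a; rewrite subr0 => aD e e0.
pose tau : R := Num.min (e / 2) (Num.min (D / 2 / k.+1%:R) (sigma / (k.+1%:R * C1))).
have tau0 : 0 < tau by rewrite !lt_min !divr_gt0// mulr_gt0.
have : tau <= tau by []; rewrite {2}/tau !le_min => /and3P[te tD ts].
exists tau; split => //; first lra.
have near_a x : a <= x <= a + tau *+ k -> `|x| < D.
  move=> /andP[ax xa]; rewrite -(subrK a x); apply: le_lt_trans (ler_normD _ _) _.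
  rewrite ger0_norm ?subr_ge0// [ltRHS](_ : _ = D / 2 + D / 2); last by rewrite -splitr.
  rewrite ler_ltD//; apply: le_trans (_ : tau * k.+1%:R <= _); last by rewrite -ler_pdivlMr.
  rewrite lerBlDl (le_trans xa)// lerD2l -[leLHS]mulr_natr ler_wpM2l ?(ltW tau0)//.
  by rewrite ler_nat.
have node i : (i <= k)%N -> `|a + tau *+ i| < D.
  move=> ik; apply: near_a; rewrite lerDl mulrn_wge0 ?(ltW tau0)//= lerD2l.
  by rewrite ler_wpMn2l ?(ltW tau0).
pose A m (s : seq R) : R := b m * \prod_(x <- s) x.
have Aadd m s1 s2 u v : (size s1 + size s2).+1 = m ->
    A m (s1 ++ (u + v) :: s2) = A m (s1 ++ u :: s2) + A m (s1 ++ v :: s2).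
  by move=> _; rewrite /A !big_cat !big_cons /=; ring.
have Abd m s : size s = m -> all (fun x : R => `|x| <= 1) s ->
    `|A m s| <= K ^+ m.+1 * \prod_(x <- s) `|x|.
  by move=> _ _; rewrite /A normrM normr_prod ler_wpM2r ?prodr_ge0.
rewrite fdiff_altsum [tau ^+ k * _](_ : _ =
  tau ^+ k * k`!%:R * (2 * K * (8 * C1 / sigma) ^+ k)); last by ring.
apply: (@altsum_series_fact_bound R R A K Aadd Abd
  (fun j => fdiff (nseq j tau) w a) k sigma sigma C1 tau) => //.
- by lra.
- exact: ltW.
- exact: ltW.
- apply: le_trans (_ : k.+1%:R * C1 * tau <= _).
    by rewrite !ler_wpM2r ?(ltW tau0) ?(ltW C10)// ler_nat.
  by rewrite mulrC -ler_pdivlMr// mulr_gt0.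
- have E3 (s : R) : K * (s + 2 * s) = 3 * (K * s) by ring.
  by rewrite E3; lra.
- by lra.
- by have := node 0%N isT; rewrite mulr0n addr0 => /DP[_ _ /ltW].
- move=> j /andP[j0 jk].
  apply: le_trans (_ : tau ^+ j * (M * C ^+ j * j`!%:R) <= _).
    apply: (@fdiff_norm R j (fun i => derive1n i w) a (a + tau *+ k) tau _ (ltW tau0)).
    - by rewrite lerD2l ler_wpMn2l ?(ltW tau0).
    - move=> i x /near_a/DP[_ xd _ _]; apply: is_derive1n; apply: (H i x _).1.
      by rewrite subr0.
    - by move=> x /near_a/DP[_ xd _ _]; apply: (H j x _).2; rewrite subr0.
  rewrite -[leRHS]mulrA ler_wpM2l ?exprn_ge0 ?(ltW tau0)// [leLHS]mulrC ler_wpM2l//.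
  rewrite exprMn ler_wpM2r ?exprn_ge0 ?(ltW C0)//.
  case: j j0 {jk} => // j _; rewrite exprS; apply: le_trans (_ : M + 1 <= _).
    by rewrite lerDl.
  by rewrite ler_peMr ?exprn_ege1 ?addr_ge0// lerDr.
move=> i ik; rewrite -fdiff_newton//.
have [nr nd ns ndelta] := DP _ (node i ik).
rewrite (gqw _ nr).
have /Hq : ball (0 : R) delta (w (a + tau *+ i)) by rewrite /ball /= sub0r normrN.
rewrite subr0 => cvgq.
rewrite (_ : (fun m => _) = fun m => b m * w (a + tau *+ i) ^+ m); first exact: cvgq.
apply/funext => m; rewrite /A; congr (_ * _).
by elim: m => [|m IH]; [rewrite big_nil expr0|rewrite /= big_cons IH exprS].
Qed.

Lemma analytic_at_affine (g : R -> R) (t p : R) : p != 0 ->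
  analytic_at g 0 -> analytic_at (fun s => g ((s - t) / p)) t.
Proof.
move=> p0 [b /nbhs_ballP[d /= d0 Hb]]; exists (fun k => b k / p ^+ k).
apply/nbhs_ballP; exists (d * `|p|); first by rewrite /= mulr_gt0// normr_gt0.
move=> s; rewrite /ball /= distrC => sd.
have /Hb : ball (0 : R) d ((s - t) / p).
  by rewrite /ball /= sub0r normrN normf_div ltr_pdivrMr// normr_gt0.
rewrite subr0 /pseries => cvgb.
rewrite (_ : (fun k => _) = fun k => b k * ((s - t) / p) ^+ k); first exact: cvgb.
by apply/funext => k /=; rewrite exprMn exprVn; ring.
Qed.

End Composition.

(** Test curves must stay in [U] for all times, which the line need not do. It is therefore
    reparametrized twice: by s plateau(s), giving a globally smooth [g] that is [l \o f] on the
    rescaled line near 0, and by the logistic function, giving an analytic [q]; near 0, [g] is [q]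
    after [logit]. *)
Lemma analytic_map_along_lines (R : realType) (E F : lmodType R)
    (E' : set (E -> R)) (F' : set (F -> R)) (U : set E) (f : E -> F) :
  dual_pair E' -> cinfty_open E' U ->
  analytic_map E' F' U f -> analytic_along_lines F' U f.
Proof.
move=> dpE openU [sf af] l Fl x v Ux t Ut.
pose line (y w : E) (h : R -> R) s := y + h s *: w.
have line_comp y w h l' : E' l' -> l' \o line y w h = fun s => l' y + l' w * h s.
  move=> El; have [_ lD _ lZ] := dual_pair_linear dpE El.
  by apply/funext => s; rewrite /line /= lD lZ mulrC.
have smooth_line y w h : smooth_fun h -> smooth_curve E' (line y w h).
  move=> sh l' El; rewrite line_comp//; apply: smooth_funD; first exact: smooth_fun_cst.
  by apply: smooth_funM => //; exact: smooth_fun_cst.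
have [e e0 Ue] : exists2 e, 0 < e & forall s, `|s| < e -> U (x + t *: v + s *: v).
  have /openU := smooth_line (x + t *: v) v id (@smooth_fun_id R).
  rewrite openE => /(_ 0); rewrite /= /line scale0r addr0 => /(_ Ut).
  rewrite /interior => /nbhs_ballP[e /= e0 He]; exists e => // s se.
  by apply: (He s); rewrite /ball /= sub0r normrN.
pose y := x + t *: v; pose w := e *: v.
have Uw s : `|s| < 1 -> U (y + s *: w).
  move=> s1; rewrite /w scalerA; apply: Ue.
  by rewrite normrM (gtr0_norm e0) gtr_pMl.
pose g := l \o (f \o line y w (fun s => s * plateau s)).
have ps (s : R) : `|s * plateau s| < 1.
  have [s4|s4] := ltP `|s| 4^-1; last by rewrite plateau_eq0// mulr0 normr0.
  rewrite normrM; apply: le_lt_trans (_ : `|s| * 1 < 1).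
    by rewrite ler_wpM2l// plateau_norm.
  by lra.
have sg : smooth_fun g.
  apply: (sf (line y w (fun s => s * plateau s))) => //.
    apply: smooth_line; apply: smooth_funM; first exact: smooth_fun_id.
    exact: smooth_plateau.
  by move=> _ [s _ <-]; exact: Uw.
pose q := l \o (f \o line y w (fun s => - 2^-1 + 1 * logistic s)).
have aq : analytic_fun q.
  apply: (af (line y w (fun s => - 2^-1 + 1 * logistic s))) => //.
    move=> l' El; rewrite line_comp//.
    rewrite (_ : (fun s => _) = fun s => (l' y - l' w * 2^-1) + l' w * logistic s).
      exact: analytic_logistic.
    by apply/funext => s; ring.
  move=> _ [s _ <-]; apply: Uw; have /andP[L0 L1] := logistic_itv s.
  by rewrite ltr_norml; apply/andP; split; lra.
have ag : analytic_at g 0.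
  apply: (@analytic_at_comp R g q (@logit R) 8^-1 sg (aq 0)) => //.
  - exact: analytic_logit.
  - exact: logit0.
  move=> u u8; rewrite /g /q /line /= logistic_logit; last by lra.
  by rewrite plateau_eq1 ?(ltW u8)// mulr1 mul1r addrA addNr add0r.
have [b Hb] := analytic_at_affine t (lt0r_neq0 e0) ag; exists b.
near=> s.
have -> : l (f (x + s *: v)) = g ((s - t) / e).
  rewrite /g /line /= plateau_eq1.
    rewrite mulr1 /w scalerA mulfVK ?lt0r_neq0// /y -addrA -scalerDl.
    by rewrite addrCA subrr addr0.
  rewrite normf_div (gtr0_norm e0) ler_pdivrMr//; near: s.
  have e8 : 0 < 8^-1 * e by rewrite mulr_gt0.
  by apply: filterS (near_dist_lt t e8) => s /ltW.
by near: s.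
Unshelve. all: by end_near.
Qed.

Theorem theorem2p7 (R : realType) (E F : lmodType R)
    (E' : set (E -> R)) (F' : set (F -> R))
    (dpE : dual_pair E') (completeE : dp_complete E')
    (dpF : dual_pair F') (completeF : dp_complete F')
    (U : set E) (openU : cinfty_open E' U) (f : E -> F) :
  analytic_map E' F' U f <->
  smooth_map E' F' U f /\ analytic_along_lines F' U f.
Proof.
split=> [af|[sf lf]]; first by split; [exact: af.1|exact: analytic_map_along_lines af].
split=> // c ac cU l Fl.
apply: (@analytic_along_analytic_curve R E E' U (l \o f) c) => //.
  by move=> c' sc' c'U; exact: sf.
by move=> x v Ux t Ut; exact: (lf l Fl x v Ux t Ut).
Qed.
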